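(* For any field $k$ there exists a unique morphism of props \[ \blacksquare \colon \mathrm{Circ}_k \cong \mathrm{FinCospan} + F(k) \to \mathrm{LagRel}_k \] such that $\blacksquare|_{\mathrm{FinCospan}}$ is the composite \[ \mathrm{FinCospan} \xrightarrow{H} \mathrm{FinCorel} \xrightarrow{K} \mathrm{LagRel}_k \] and for each $Z \in k$, the linear Lagrangian relation $\blacksquare(Z)$ from $k\oplus k$ to $k \oplus k$ is given by \[ \blacksquare(Z) = \{(\phi_1,I_1,\phi_2,I_2) : \phi_2-\phi_1 = Z I_1,\ I_1 = I_2\}. \]
   Context: Props. A prop is a strict symmetric monoidal category having the natural numbers as objects, with tensor product of objects given by addition; a morphism of props is a strict symmetric monoidal functor that is the identity on objects. $\mathrm{PROP}$ is the category of props; $+$ denotes coproduct in $\mathrm{PROP}$. A signature is a family of sets $\Sigma(m,n)$, $m,n\in\mathbb{N}$; $F$ is the left adjoint of the forgetful functor from props to signatures (free prop). $\mathrm{FinCospan}$ and $\mathrm{FinCorel}$. $\mathrm{FinCospan}$ is the prop whose morphisms $m \to n$ are isomorphism classes of cospans of finite sets $m \to S \leftarrow n$ (with $n$ standing for an $n$-element ordinal), composed by pushout, tensored by disjoint union. A corelation from $X$ to $Y$ is a partition of $X+Y$, equivalently an isomorphism class of jointly epic cospans $X \xrightarrow{f} S \xleftarrow{g} Y$ (meaning $f(X)\cup g(Y)=S$). $\mathrm{FinCorel}$ is the prop whose morphisms $m\to n$ are corelations from $m$ to $n$; composition is by pushout of cospans followed by restricting the apex to the union of the images of the two legs; tensor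 is disjoint union. $H\colon \mathrm{FinCospan}\to\mathrm{FinCorel}$ is the morphism of props sending a cospan $X \xrightarrow{f} S \xleftarrow{g} Y$ to the jointly epic cospan $X \to f(X)\cup g(Y) \leftarrow Y$. Circuits. For a set $\mathcal{L}$, an $\mathcal{L}$-circuit from a finite set $X$ to a finite set $Y$ is a cospan of finite sets $X \xrightarrow{i} N \xleftarrow{o} Y$ together with a finite set $E$ of edges, source and target maps $s,t\colon E\to N$ and a labeling $\ell\colon E\to\mathcal{L}$. Isomorphisms are bijections of nodes and of edges compatible with all this structure (and with the identity on $X$, $Y$). Composition glues outputs to inputs by pushout of cospans and takes the disjoint union of the edge sets; tensor product is disjoint union. $\mathrm{Circ}_{\mathcal{L}}$ is the prop whose morphisms $m\to n$ are isomorphism classes of $\mathcal{L}$-circuits from $m$ to $n$. Let $F(\mathcal{L})$ be the free prop on the signature having one operation $1\to1$ for each element of $\mathcal{L}$ and no others. One identifies $\mathrm{Circ}_{\mathcal{L}} \cong \mathrm{FinCospan}+F(\mathcal{L})$: a cospan corresponds to a circuit with no edges, and the generator $\ell\in\mathcal{L}$ to the circuit $1\to1$ with two nodes and a single edge labeled $\ell$ from the input node to the output node. $\mathrm{Circ}_k$ is the case where $\mathcal{L}$ is the set of elements of the field $k$. Lagrangian relations. A symplectic vector space over $k$ is a finite-dimensional vector space with a bilinear, alternating, nondegenerate form $\omega$. A subspace $L$ of $(V,\omega)$ is isotropic if $\omega(v,w)=0$ for all $v,w\in L$, and Lagrangian if it is isotropic and not properly contained in another isotropic subspace. $\overline{V}$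 denotes $V$ with form $-\omega$. A linear Lagrangian relation from $V$ to $V'$ is a Lagrangian subspace of $\overline{V}\oplus V'$. $k\oplus k$ has the symplectic structure $\omega((\phi,I),(\phi',I'))=\phi I'-\phi' I$, and $(k\oplus k)^n$ the direct sum structure. $\mathrm{LagRel}_k$ is the prop where a morphism $m\to n$ is a linear Lagrangian relation from $(k\oplus k)^m$ to $(k\oplus k)^n$, composition is composition of relations, and the symmetric monoidal structure is direct sum. The functor $K$. $K\colon\mathrm{FinCorel}\to\mathrm{LagRel}_k$ is the morphism of props that sends the one-block corelations $\mu\colon2\to1$ and $\delta\colon1\to2$ and the unique corelations $\iota\colon0\to1$ and $\epsilon\colon1\to0$ (which generate $\mathrm{FinCorel}$) to $K(\mu)=\{(\phi_1,I_1,\phi_2,I_2,\phi_3,I_3):\phi_1=\phi_2=\phi_3,\ I_1+I_2=I_3\}$, $K(\delta)=\{(\phi_1,I_1,\phi_2,I_2,\phi_3,I_3):\phi_1=\phi_2=\phi_3,\ I_1=I_2+I_3\}$, $K(\iota)=\{(\phi_2,I_2): I_2=0\}$, $K(\epsilon)=\{(\phi_1,I_1): I_1=0\}$. *)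

(* Defs.v *)
From HB Require Import structures.
From mathcomp Require Import all_boot all_order all_algebra.
From mathcomp Require Import boolp ring.

Set Implicit Arguments.
Unset Strict Implicit.
Unset Printing Implicit Defensive.

Import GRing.Theory.

(* Props are strict: the associator and unitors are identities, but m + (n + p)
   and m + n + p are different terms, hence the transports by hcast below.     *)
Definition hcast (hom : nat -> nat -> Type) (m m' n n' : nat)
    (em : m = m') (en : n = n') (f : hom m n) : hom m' n' :=
  match en in _ = b return hom m' b with
  | erefl => match em in _ = a return hom a n with erefl => f end
  end.

(* Composition is written in diagrammatic order. *)
Record prop := MkProp {
  hom : nat -> nat -> Type;
  prop_id : forall n, hom n n;
  prop_comp : forall m n p, hom m n -> hom n p -> hom m p;
  prop_tens : forall m n p q, hom m n -> hom p q -> hom (m + p) (n + q);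
  prop_sym : forall m n, hom (m + n) (n + m);
  prop_compA : forall m n p q (f : hom m n) (g : hom n p) (h : hom p q),
    prop_comp f (prop_comp g h) = prop_comp (prop_comp f g) h;
  prop_comp1f : forall m n (f : hom m n), prop_comp (prop_id m) f = f;
  prop_compf1 : forall m n (f : hom m n), prop_comp f (prop_id n) = f;
  prop_tens11 : forall m n, prop_tens (prop_id m) (prop_id n) = prop_id (m + n);
  prop_tens_comp : forall m n p m' n' p' (f : hom m n) (g : hom n p)
      (f' : hom m' n') (g' : hom n' p'),
    prop_tens (prop_comp f g) (prop_comp f' g') = prop_comp (prop_tens f f') (prop_tens g g');
  prop_tensA : forall m n p m' n' p' (f : hom m m') (g : hom n n') (h : hom p p'),
    hcast (addnA m n p) (addnA m' n' p') (prop_tens f (prop_tens g h)) =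
    prop_tens (prop_tens f g) h;
  prop_tens0f : forall m n (f : hom m n),
    hcast (add0n m) (add0n n) (prop_tens (prop_id 0) f) = f;
  prop_tensf0 : forall m n (f : hom m n),
    hcast (addn0 m) (addn0 n) (prop_tens f (prop_id 0)) = f;
  prop_sym_nat : forall m n m' n' (f : hom m m') (g : hom n n'),
    prop_comp (prop_tens f g) (prop_sym m' n') = prop_comp (prop_sym m n) (prop_tens g f);
  prop_symK : forall m n, prop_comp (prop_sym m n) (prop_sym n m) = prop_id (m + n);
  prop_sym_hex : forall m n p,
    prop_sym m (n + p) =
    hcast (esym (addnA m n p)) (addnA n p m)
      (prop_comp (hcast erefl (esym (addnA n m p)) (prop_tens (prop_sym m n) (prop_id p)))
             (prop_tens (prop_id n) (prop_sym m p)))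
}.

Record prop_mor (A B : prop) := PropMor {
  mor_map : forall m n, hom A m n -> hom B m n;
  mor_map_id : forall n, mor_map (prop_id A n) = prop_id B n;
  mor_map_comp : forall m n p (f : hom A m n) (g : hom A n p),
    mor_map (prop_comp f g) = prop_comp (mor_map f) (mor_map g);
  mor_map_tens : forall m n p q (f : hom A m n) (g : hom A p q),
    mor_map (prop_tens f g) = prop_tens (mor_map f) (mor_map g);
  mor_map_sym : forall m n, mor_map (prop_sym A m n) = prop_sym B m n
}.

Definition prop_mor_comp (A B C : prop) (G : prop_mor B C) (F : prop_mor A B) :
  prop_mor A C.
Proof.
exists (fun m n f => mor_map G (mor_map F f)).
- by move=> n; rewrite !mor_map_id.
- by move=> m n p f g; rewrite !mor_map_comp.
- by move=> m n p q f g; rewrite !mor_map_tens.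
- by move=> m n; rewrite !mor_map_sym.
Defined.

(* Isomorphism classes: cospans and circuits range over all finite sets, so they
   live in a larger universe than the carriers of choiceType and {eq_quot _};
   a class is here a predicate.                                              *)
Section Quotient.
Variables (T : Type) (R : T -> T -> Prop).
Hypothesis Rrefl : forall x, R x x.
Hypothesis Rsym : forall x y, R x y -> R y x.
Hypothesis Rtrans : forall x y z, R x y -> R y z -> R x z.

Definition quot : Type := {P : T -> Prop | exists x, P = R x}.

Definition cls (x : T) : quot := exist _ (R x) (ex_intro _ x erefl).

Definition qrepr (q : quot) : T := sval (cid (svalP q)).

Lemma qreprK q : cls (qrepr q) = q.
Proof.
case: q => P hP; apply: eq_exist.
by rewrite /qrepr /=; case: cid => x /= ->.
Qed.

Lemma eq_cls x y : R x y -> cls x = cls y.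
Proof.
move=> xy; apply: eq_exist; apply/funext => z; apply/propext.
by split=> [xz|]; [exact: Rtrans (Rsym xy) xz|exact: Rtrans xy].
Qed.

Lemma cls_eq x y : cls x = cls y -> R x y.
Proof. by move=> /(congr1 sval) /= ->. Qed.

Lemma repr_cls x : R x (qrepr (cls x)).
Proof. by apply: cls_eq; rewrite qreprK. Qed.

End Quotient.
Arguments cls {T} R x.
Arguments qrepr {T R} q.

Definition sum_map (A B A' B' : Type) (f : A -> A') (g : B -> B')
    (x : A + B) : A' + B' :=
  match x with inl a => inl (f a) | inr b => inr (g b) end.

Definition sum_swap (A B : Type) (x : A + B) : B + A :=
  match x with inl a => inr a | inr b => inl b end.

Section Pushout.
Variables (B S T : finType) (g : B -> S) (f : B -> T).

Definition glue : rel (S + T)%type := fun x y =>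
  match x, y with
  | inl s, inr t => [exists b, (g b == s) && (f b == t)]
  | inr t, inl s => [exists b, (g b == s) && (f b == t)]
  | _, _ => false
  end.

(* The quotient of S + T by the equivalence relation generated by
   g b ~ f b; each equivalence class is represented by its root.   *)
Definition pushout : finType := {x : (S + T)%type | roots glue x}.

Lemma glue_sym : connect_sym glue.
Proof. by apply: sym_connect_sym => -[s|t] [s'|t']. Qed.

Definition po_in (x : S + T) : pushout :=
  exist _ (fingraph.root glue x) (roots_root glue_sym x).
Definition po_inl (s : S) : pushout := po_in (inl s).
Definition po_inr (t : T) : pushout := po_in (inr t).

Definition is_po (U : Type) (a : S -> U) (b : T -> U) : Prop :=
  [/\ forall x, a (g x) = b (f x),
      forall u, (exists s, u = a s) \/ (exists t, u = b t) &
      forall (X : Type) (p : S -> X) (q : T -> X), (forall x, p (g x) = q (f x)) ->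
        exists r : U -> X, (forall s, r (a s) = p s) /\ (forall t, r (b t) = q t)].

Lemma pushoutP : is_po po_inl po_inr.
Proof.
split.
- move=> x; apply: val_inj; apply/fingraph.rootP; first exact: glue_sym.
  by apply: connect1 => /=; apply/existsP; exists x; rewrite !eqxx.
- move=> [[s|t] rx]; [left; exists s|right; exists t];
    by apply: val_inj => /=; rewrite (eqP rx).
- move=> X p q pq; pose h (x : S + T) := match x with inl s => p s | inr t => q t end.
  have h_conn x y : connect glue x y -> h x = h y.
    case/connectP => pth; elim: pth x => [|z pth IH] x /= => [_ -> //|].
    case/andP => xz /IH{}IH /IH <-; case: x z xz {IH} => [s|t] [s'|t'] //=;
      by case/existsP => b /andP[/eqP <- /eqP <-].
  exists (fun u => h (val u)); split=> [s|t] /=.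
    by rewrite -[RHS]/(h (inl s)); apply/esym/h_conn/connect_root.
  by rewrite -[RHS]/(h (inr t)); apply/esym/h_conn/connect_root.
Qed.

Lemma is_po_iso (U V : Type) (a : S -> U) (b : T -> U) (a' : S -> V) (b' : T -> V) :
  is_po a b -> is_po a' b' ->
  exists h : U -> V, [/\ bijective h, forall s, h (a s) = a' s & forall t, h (b t) = b' t].
Proof.
move=> [ab jU uU] [ab' jV uV].
have [h [ha hb]] := uU V a' b' ab'; have [h' [ha' hb']] := uV U a b ab.
exists h; split=> //; exists h' => u.
  by case: (jU u) => -[x ->]; rewrite ?ha ?hb ?ha' ?hb'.
by case: (jV u) => -[x ->]; rewrite ?ha' ?hb' ?ha ?hb.
Qed.

End Pushout.

Record cospan (m n : nat) := Cospan {
  apex : finType;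
  lleg : 'I_m -> apex;
  rleg : 'I_n -> apex
}.

Definition cospan_iso m n (c d : cospan m n) : Prop :=
  exists h : apex c -> apex d, [/\ bijective h,
    forall i, h (lleg c i) = lleg d i & forall j, h (rleg c j) = rleg d j].

Definition cospan_id n : cospan n n := @Cospan n n 'I_n id id.

Definition cospan_comp m n p (c : cospan m n) (d : cospan n p) : cospan m p :=
  @Cospan m p (pushout (rleg c) (lleg d))
    (fun i => po_inl (rleg c) (lleg d) (lleg c i))
    (fun j => po_inr (rleg c) (lleg d) (rleg d j)).

Definition cospan_tens m n p q (c : cospan m n) (d : cospan p q) :
  cospan (m + p) (n + q) :=
  @Cospan (m + p) (n + q) (apex c + apex d)%type
    (fun i => sum_map (lleg c) (lleg d) (split i))
    (fun j => sum_map (rleg c) (rleg d) (split j)).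

Definition ord_swap m n (i : 'I_(m + n)) : 'I_(n + m) := unsplit (sum_swap (split i)).

(* The legs are the identity of m + n and the block swap n + m -> m + n. *)
Definition cospan_sym m n : cospan (m + n) (n + m) :=
  @Cospan (m + n) (n + m) 'I_(m + n) id (@ord_swap n m).

Definition cospan_cls (m n : nat) : Type := quot (@cospan_iso m n).

Section Circuit.
Variable L : Type.

Record circuit (m n : nat) := Circuit {
  nodes :> cospan m n;
  edges : finType;
  src : edges -> apex nodes;
  tgt : edges -> apex nodes;
  lab : edges -> L
}.

Definition circuit_iso m n (c d : circuit m n) : Prop :=
  exists (h : apex c -> apex d) (e : edges c -> edges d),
    [/\ bijective h, forall i, h (lleg c i) = lleg d i
      & forall j, h (rleg c j) = rleg d j] /\
    [/\ bijective e, forall x, src (e x) = h (src x), forall x, tgt (e x) = h (tgt x)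
      & forall x, lab (e x) = lab x].

Definition circuit_of_cospan m n (c : cospan m n) : circuit m n :=
  @Circuit m n c void (of_void _) (of_void _) (of_void _).

Definition circuit_comp m n p (c : circuit m n) (d : circuit n p) : circuit m p :=
  let a := po_inl (rleg c) (lleg d) in
  let b := po_inr (rleg c) (lleg d) in
  @Circuit m p (cospan_comp c d) (edges c + edges d)%type
    (fun x => match x with inl x => a (src x) | inr x => b (src x) end)
    (fun x => match x with inl x => a (tgt x) | inr x => b (tgt x) end)
    (fun x => match x with inl x => lab x | inr x => lab x end).

Definition circuit_tens m n p q (c : circuit m n) (d : circuit p q) :
  circuit (m + p) (n + q) :=
  @Circuit (m + p) (n + q) (cospan_tens c d) (edges c + edges d)%type
    (sum_map (@src _ _ c) (@src _ _ d))
    (sum_map (@tgt _ _ c) (@tgt _ _ d))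
    (fun x => match x with inl x => lab x | inr x => lab x end).

(* Two nodes joined by one edge, from the input node to the output node. *)
Definition circuit_edge (l : L) : circuit 1 1 :=
  @Circuit 1 1 (@Cospan 1 1 bool (fun _ => false) (fun _ => true)) unit
    (fun _ => false) (fun _ => true) (fun _ => l).

Definition circuit_cls (m n : nat) : Type := quot (@circuit_iso m n).

Definition circ_id n : circuit_cls n n := cls _ (circuit_of_cospan (cospan_id n)).
Definition circ_comp m n p (x : circuit_cls m n) (y : circuit_cls n p) :
  circuit_cls m p := cls _ (circuit_comp (qrepr x) (qrepr y)).
Definition circ_tens m n p q (x : circuit_cls m n) (y : circuit_cls p q) :
  circuit_cls (m + p) (n + q) := cls _ (circuit_tens (qrepr x) (qrepr y)).
Definition circ_sym m n : circuit_cls (m + n) (n + m) :=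
  cls _ (circuit_of_cospan (cospan_sym m n)).

Lemma circuit_iso_refl m n (c : circuit m n) : circuit_iso c c.
Proof.
exists id, id; split; split=> //; exact: (Bijective (fun _ => erefl) (fun _ => erefl)).
Qed.

Lemma circuit_iso_sym m n (c d : circuit m n) : circuit_iso c d -> circuit_iso d c.
Proof.
move=> [h [e [[[h' hK hK'] hl hr] [[e' eK eK'] es et el]]]].
exists h', e'; split; split.
- exact: (Bijective hK' hK).
- by move=> i; rewrite -hl hK.
- by move=> i; rewrite -hr hK.
- exact: (Bijective eK' eK).
- by move=> x; rewrite -[in RHS](eK' x) es hK.
- by move=> x; rewrite -[in RHS](eK' x) et hK.
- by move=> x; rewrite -[in RHS](eK' x) el.
Qed.

Lemma circuit_iso_trans m n (c d b : circuit m n) :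
  circuit_iso c d -> circuit_iso d b -> circuit_iso c b.
Proof.
move=> [h [e [[hb hl hr] [eb es et el]]]] [h' [e' [[hb' hl' hr'] [eb' es' et' el']]]].
exists (h' \o h), (e' \o e); split; split=> /=.
- exact: bij_comp.
- by move=> i; rewrite hl.
- by move=> i; rewrite hr.
- exact: bij_comp.
- by move=> x; rewrite es' es.
- by move=> x; rewrite et' et.
- by move=> x; rewrite el' el.
Qed.

Lemma eq_ccls m n (c d : circuit m n) :
  circuit_iso c d -> cls (@circuit_iso m n) c = cls _ d.
Proof. exact: eq_cls (@circuit_iso_sym m n) (@circuit_iso_trans m n) _ _. Qed.

Lemma ccls_eq m n (c d : circuit m n) :
  cls (@circuit_iso m n) c = cls _ d -> circuit_iso c d.
Proof. exact: cls_eq (@circuit_iso_refl m n) _ _. Qed.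

Lemma circW m n (x : circuit_cls m n) : exists c, x = cls _ c.
Proof. by exists (qrepr x); rewrite qreprK. Qed.

Lemma bij_sum_map (A B A' B' : Type) (f : A -> A') (g : B -> B') :
  bijective f -> bijective g -> bijective (sum_map f g).
Proof.
move=> [f' fK fK'] [g' gK gK']; exists (sum_map f' g') => -[x|x] /=;
  by rewrite ?fK ?fK' ?gK ?gK'.
Qed.

Lemma bij_sum_swap (A B : Type) : bijective (@sum_swap A B).
Proof. by exists (@sum_swap B A) => -[]. Qed.

Lemma circ_comp_po m n p (c : circuit m n) (d : circuit n p) (U : finType)
    (a : apex c -> U) (b : apex d -> U) :
  is_po (rleg c) (lleg d) a b ->
  circ_comp (cls _ c) (cls _ d) = cls _ (@Circuit m p
    (@Cospan m p U (fun i => a (lleg c i)) (fun j => b (rleg d j)))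
    (edges c + edges d)%type
    (fun x => match x with inl x => a (src x) | inr x => b (src x) end)
    (fun x => match x with inl x => a (tgt x) | inr x => b (tgt x) end)
    (fun x => match x with inl x => lab x | inr x => lab x end)).
Proof.
move=> po; apply: eq_ccls.
have [h [e [[hb hl hr] [eb es et el]]]] := repr_cls (@circuit_iso_refl m n) c.
have [h' [e' [[hb' hl' hr'] [eb' es' et' el']]]] := repr_cls (@circuit_iso_refl n p) d.
move: (qrepr _) (qrepr _) h e h' e' hb hl hr eb es et el hb' hl' hr' eb' es' et' el'
  => d' c' h e h' e' hb hl hr eb es et el hb' hl' hr' eb' es' et' el'.
case: (pushoutP (rleg c') (lleg d')) => ab j u.
have po' : is_po (rleg c) (lleg d) (po_inl (rleg c') (lleg d') \o h)
                 (po_inr (rleg c') (lleg d') \o h').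
  case: (hb) (hb') => [k hK kK] [k' hK' kK']; split=> /=.
  - by move=> x; rewrite hr hl'.
  - move=> x; case: (j x) => -[s ->]; [left; exists (k s)|right; exists (k' s)];
      by rewrite ?kK ?kK'.
  - move=> X q r qr; have [|w [wl wr]] := u X (q \o k) (r \o k').
      by move=> x /=; rewrite -hr -hl' hK hK'.
    by exists w; split=> [s|t]; rewrite ?wl ?wr /= ?hK ?hK'.
have [g [gb gl gr]] := is_po_iso po po'.
apply: circuit_iso_sym; exists g, (sum_map e e'); split; split=> //=.
- by move=> i; rewrite gl /= hl.
- by move=> i; rewrite gr /= hr'.
- exact: bij_sum_map.
- by move=> [x|x] /=; rewrite ?gl ?gr /= ?es ?es'.
- by move=> [x|x] /=; rewrite ?gl ?gr /= ?et ?et'.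
- by move=> [x|x] /=; rewrite ?el ?el'.
Qed.

Lemma circ_tensE m n p q (c : circuit m n) (d : circuit p q) :
  circ_tens (cls _ c) (cls _ d) = cls _ (circuit_tens c d).
Proof.
apply: eq_ccls; apply: circuit_iso_sym.
have [h [e [[hb hl hr] [eb es et el]]]] := repr_cls (@circuit_iso_refl m n) c.
have [h' [e' [[hb' hl' hr'] [eb' es' et' el']]]] := repr_cls (@circuit_iso_refl p q) d.
exists (sum_map h h'), (sum_map e e'); split; split=> //=;
  try exact: bij_sum_map.
- by move=> i; case: (split i) => x /=; rewrite ?hl ?hl'.
- by move=> i; case: (split i) => x /=; rewrite ?hr ?hr'.
- by move=> [x|x] /=; rewrite ?es ?es'.
- by move=> [x|x] /=; rewrite ?et ?et'.
- by move=> [x|x] /=; rewrite ?el ?el'.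
Qed.

Lemma circ_hcastE m m' n n' (em : m = m') (en : n = n') (c : circuit m n) :
  @hcast circuit_cls _ _ _ _ em en (cls _ c) = cls _ (@Circuit m' n'
    (@Cospan m' n' (apex c) (fun i => lleg c (cast_ord (esym em) i))
                            (fun i => rleg c (cast_ord (esym en) i)))
    (edges c) (@src _ _ c) (@tgt _ _ c) (@lab _ _ c)).
Proof.
case: m' / em; case: n' / en; apply: eq_ccls.
exists id, id; split; split=> //=; try (by exists id); by move=> i; rewrite cast_ord_id.
Qed.

Definition graph m n (h : 'I_m -> 'I_n) : circuit_cls n m :=
  cls _ (circuit_of_cospan (@Cospan n m 'I_n id h)).

Lemma bij_inl_void (A : Type) : bijective (fun x : A + void => match x with inl a => a | inr v => of_void A v end).
Proof. by exists inl => // -[|[]]. Qed.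

Lemma bij_inr_void (A : Type) : bijective (fun x : void + A => match x with inl v => of_void A v | inr a => a end).
Proof. by exists inr => // -[[]|]. Qed.

Lemma circ_comp_graph m n p (c : circuit m n) (h : 'I_p -> 'I_n) :
  circ_comp (cls _ c) (graph h) = cls _ (@Circuit m p
    (@Cospan m p (apex c) (lleg c) (rleg c \o h)) (edges c) (@src _ _ c) (@tgt _ _ c) (@lab _ _ c)).
Proof.
rewrite (@circ_comp_po _ _ _ c (circuit_of_cospan (@Cospan n p 'I_n id h))
  (apex c) id (rleg c)).
  apply: eq_ccls; exists id; eexists; split; split=> //=; try exact: bij_inl_void.
  - by exists id.
  - by move=> [x|[]].
  - by move=> [x|[]].
  - by move=> [x|[]].
split=> //=; first by move=> u; left; exists u.
by move=> X q r qr; exists q; split.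
Qed.

Lemma circ_graph_comp m n p (c : circuit n p) (h : 'I_n -> 'I_m) (k : 'I_m -> 'I_n) :
  cancel h k -> cancel k h ->
  circ_comp (graph h) (cls _ c) = cls _ (@Circuit m p
    (@Cospan m p (apex c) (lleg c \o k) (rleg c)) (edges c) (@src _ _ c) (@tgt _ _ c) (@lab _ _ c)).
Proof.
move=> hK kK; rewrite (@circ_comp_po _ _ _ (circuit_of_cospan (@Cospan m n 'I_m id h)) c
  (apex c) (lleg c \o k) id).
  apply: eq_ccls; exists id; eexists; split; split=> //=; try exact: bij_inr_void.
  - by exists id.
  - by move=> [[]|x].
  - by move=> [[]|x].
  - by move=> [[]|x].
split=> /=; first by move=> x; rewrite hK.
  by move=> u; right; exists u.
by move=> X q r qr; exists r; split=> // s /=; rewrite -qr kK.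
Qed.

Lemma circ_graph_comp_graph m n p (h : 'I_n -> 'I_m) (k : 'I_p -> 'I_n) :
  circ_comp (graph h) (graph k) = graph (h \o k).
Proof. by rewrite circ_comp_graph. Qed.

Definition ord_sum m n p q (h : 'I_m -> 'I_n) (k : 'I_p -> 'I_q) (i : 'I_(m + p)) :
  'I_(n + q) := unsplit (sum_map h k (split i)).

Lemma circ_tens_graph m n p q (h : 'I_m -> 'I_n) (k : 'I_p -> 'I_q) :
  circ_tens (graph h) (graph k) = graph (ord_sum h k).
Proof.
rewrite circ_tensE; apply: eq_ccls.
exists unsplit, (fun x : void + void => match x with inl v => v | inr v => v end).
split; split=> //=; try (by move=> [[]|[]]).
- by exists split; [exact: unsplitK|exact: splitK].
- by move=> i; rewrite -[RHS]splitK; case: (split i).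
- by exists inl => -[] // [].
Qed.

Lemma hcast_graph m m' n n' (em : m = m') (en : n = n') (h : 'I_n -> 'I_m) :
  @hcast circuit_cls _ _ _ _ em en (graph h) =
  graph (fun i => cast_ord em (h (cast_ord (esym en) i))).
Proof.
case: m' / em; case: n' / en; congr graph; apply/funext => i.
by rewrite !cast_ord_id.
Qed.

Lemma circ_idE n : circ_id n = graph (@id 'I_n). Proof. by []. Qed.
Lemma circ_symE m n : circ_sym m n = graph (@ord_swap n m). Proof. by []. Qed.

Lemma ord_swapK m n : cancel (@ord_swap m n) (@ord_swap n m).
Proof. by move=> i; rewrite /ord_swap unsplitK -[RHS]splitK; case: (split i). Qed.

Lemma circ_compA m n p q (f : circuit_cls m n) (g : circuit_cls n p) (h : circuit_cls p q) :
  circ_comp f (circ_comp g h) = circ_comp (circ_comp f g) h.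
Proof.
have [[c ->] [d ->]] := (circW f, circW g); have [e ->] := circW h.
have po1 := pushoutP (rleg c) (lleg d); have po2 := pushoutP (rleg d) (lleg e).
move: (po_inl _ _) (po_inr _ _) (po_inl _ _) (po_inr _ _) po1 po2 => a2 b2 a1 b1 po1 po2.
have po3 := pushoutP b1 a2.
move: (po_inl _ _) (po_inr _ _) po3 => a3 b3 po3.
rewrite (circ_comp_po po1) (circ_comp_po po2).
set de := (X in circ_comp (cls _ c) (cls _ X)).
set cd := (X in _ = circ_comp (cls _ X) _).
case: po1 po2 po3 => [ab1 j1 u1] [ab2 j2 u2] [ab3 j3 u3].
rewrite (@circ_comp_po _ _ _ c de _ (a3 \o a1) b3); last first.
  split=> /=.
  - by move=> x; rewrite ab1 ab3.
  - move=> u; case: (j3 u) => -[s ->]; last by right; exists s.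
    case: (j1 s) => -[t ->]; first by left; exists t.
    by right; exists (a2 t); rewrite ab3.
  - move=> X p' q' pq; have [|r1 [r1a r1b]] := u1 X p' (q' \o a2); first by [].
    have [|r [ra rb]] := u3 X r1 q'; first by move=> x; rewrite r1b.
    by exists r; split=> // s /=; rewrite ra r1a.
rewrite (@circ_comp_po _ _ _ cd e _ a3 (b3 \o b2)); last first.
  split=> /=.
  - by move=> x; rewrite ab3 ab2.
  - move=> u; case: (j3 u) => -[s ->]; first by left; exists s.
    case: (j2 s) => -[t ->]; last by right; exists t.
    by left; exists (b1 t); rewrite ab3.
  - move=> X p' q' pq; have [|r1 [r1a r1b]] := u2 X (p' \o b1) q'; first by [].
    have [|r [ra rb]] := u3 X p' r1; first by move=> x; rewrite r1a.
    by exists r; split=> // s /=; rewrite rb r1b.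
apply: eq_ccls => /=; exists id.
exists (fun x : edges c + (edges d + edges e) => match x with
  | inl y => inl (inl y) | inr (inl y) => inl (inr y) | inr (inr y) => inr y end).
split; split=> //=.
- by exists id.
- by exists (fun x : (edges c + edges d) + edges e => match x with
    | inl (inl y) => inl y | inl (inr y) => inr (inl y) | inr y => inr (inr y) end)
    => [[|[]]|[[]|]].
- by move=> [x|[x|x]] //=; rewrite ab3.
- by move=> [x|[x|x]] //=; rewrite ab3.
- by move=> [x|[x|x]].
Qed.

Lemma circ_comp1f m n (f : circuit_cls m n) : circ_comp (circ_id m) f = f.
Proof. by have [c ->] := circW f; rewrite circ_idE (@circ_graph_comp _ _ _ _ _ id) //; case: c => -[]. Qed.

Lemma circ_compf1 m n (f : circuit_cls m n) : circ_comp f (circ_id n) = f.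
Proof. by have [c ->] := circW f; rewrite circ_comp_graph; case: c => -[]. Qed.

Lemma circ_tens11 m n : circ_tens (circ_id m) (circ_id n) = circ_id (m + n).
Proof.
rewrite !circ_idE circ_tens_graph; congr graph; apply/funext => i.
by rewrite /ord_sum -[RHS]splitK; case: (split i).
Qed.

Lemma circ_tens_comp m n p m' n' p' (f : circuit_cls m n) (g : circuit_cls n p)
    (f' : circuit_cls m' n') (g' : circuit_cls n' p') :
  circ_tens (circ_comp f g) (circ_comp f' g') = circ_comp (circ_tens f f') (circ_tens g g').
Proof.
have [[c ->] [d ->]] := (circW f, circW g); have [[c' ->] [d' ->]] := (circW f', circW g').
have po1 := pushoutP (rleg c) (lleg d); have po2 := pushoutP (rleg c') (lleg d').
move: (po_inl _ _) (po_inr _ _) (po_inl _ _) (po_inr _ _) po1 po2 => a2 b2 a1 b1 po1 po2.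
rewrite (circ_comp_po po1) (circ_comp_po po2) !circ_tensE.
case: po1 po2 => [ab1 j1 u1] [ab2 j2 u2].
rewrite (@circ_comp_po _ _ _ (circuit_tens c c') (circuit_tens d d') _
  (sum_map a1 a2) (sum_map b1 b2)); last first.
  split=> /=.
  - by move=> x; case: (split x) => y /=; rewrite ?ab1 ?ab2.
  - move=> [u|u].
      by case: (j1 u) => -[s ->]; [left|right]; exists (inl s).
    by case: (j2 u) => -[s ->]; [left|right]; exists (inr s).
  - move=> X p1 q1 pq.
    have [|r1 [r1a r1b]] := u1 X (p1 \o inl) (q1 \o inl).
      by move=> x; have := pq (unsplit (inl x)); rewrite unsplitK.
    have [|r2 [r2a r2b]] := u2 X (p1 \o inr) (q1 \o inr).
      by move=> x; have := pq (unsplit (inr x)); rewrite unsplitK.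
    by exists (fun x => match x with inl x => r1 x | inr x => r2 x end); split=> -[x|x] /=;
      rewrite ?r1a ?r1b ?r2a ?r2b.
apply: eq_ccls; exists id => /=.
exists (fun x : (edges c + edges d) + (edges c' + edges d') => match x with
  | inl (inl y) => inl (inl y) | inl (inr y) => inr (inl y)
  | inr (inl y) => inl (inr y) | inr (inr y) => inr (inr y) end).
split; split=> //=.
- by exists id.
- by move=> i; case: (split i).
- by move=> i; case: (split i).
- by exists (fun x : (edges c + edges c') + (edges d + edges d') => match x with
  | inl (inl y) => inl (inl y) | inl (inr y) => inr (inl y)
  | inr (inl y) => inl (inr y) | inr (inr y) => inr (inr y) end) => -[[]|[]].
- by move=> [[]|[]].
- by move=> [[]|[]].
- by move=> [[]|[]].
Qed.

Lemma splitL m n (i : 'I_m) : split (lshift n i) = inl i.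
Proof. exact: (unsplitK (inl i)). Qed.

Lemma splitR m n (i : 'I_n) : split (rshift m i) = inr i.
Proof. exact: (unsplitK (inr i)). Qed.

Lemma ord_swapL m n (i : 'I_m) : ord_swap (lshift n i) = rshift n i.
Proof. by rewrite /ord_swap splitL. Qed.

Lemma ord_swapR m n (i : 'I_n) : ord_swap (rshift m i) = lshift m i.
Proof. by rewrite /ord_swap splitR. Qed.

Lemma ord_sumL m n p q (h : 'I_m -> 'I_n) (k : 'I_p -> 'I_q) i :
  ord_sum h k (lshift p i) = lshift q (h i).
Proof. by rewrite /ord_sum splitL. Qed.

Lemma ord_sumR m n p q (h : 'I_m -> 'I_n) (k : 'I_p -> 'I_q) i :
  ord_sum h k (rshift m i) = rshift n (k i).
Proof. by rewrite /ord_sum splitR. Qed.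

Lemma cast_lshift m n p (e : m + (n + p) = m + n + p) i :
  cast_ord e (lshift (n + p) i) = lshift p (lshift n i).
Proof. exact: val_inj. Qed.

Lemma cast_mshift m n p (e : m + (n + p) = m + n + p) i :
  cast_ord e (rshift m (lshift p i)) = lshift p (rshift m i).
Proof. exact: val_inj. Qed.

Lemma cast_rshift m n p (e : m + (n + p) = m + n + p) i :
  cast_ord e (rshift m (rshift n i)) = rshift (m + n) i.
Proof. by apply: val_inj; rewrite /= addnA. Qed.

Lemma cast_lshiftV m n p (e : m + n + p = m + (n + p)) i :
  cast_ord e (lshift p (lshift n i)) = lshift (n + p) i.
Proof. exact: val_inj. Qed.

Lemma cast_mshiftV m n p (e : m + n + p = m + (n + p)) i :
  cast_ord e (lshift p (rshift m i)) = rshift m (lshift p i).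
Proof. exact: val_inj. Qed.

Lemma cast_rshiftV m n p (e : m + n + p = m + (n + p)) i :
  cast_ord e (rshift (m + n) i) = rshift m (rshift n i).
Proof. by apply: val_inj; rewrite /= addnA. Qed.

Definition cast_shift :=
  (cast_lshift, cast_mshift, cast_rshift, cast_lshiftV, cast_mshiftV, cast_rshiftV).

Lemma split_castA m n p (i : 'I_(m + n + p)) :
  split (cast_ord (esym (addnA m n p)) i) =
  match split i with
  | inl j => match split j with inl a => inl a | inr b => inr (unsplit (inl b)) end
  | inr c => inr (unsplit (inr c))
  end.
Proof.
case: (split_ordP i) => [j ->|c ->]; first case: (split_ordP j) => [a ->|b ->].
- rewrite -[RHS]unsplitK /=; congr split; exact: val_inj.
- rewrite -[RHS]unsplitK /=; congr split; exact: val_inj.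
- rewrite -[RHS]unsplitK /=; congr split; apply: val_inj; exact: esym (addnA _ _ _).
Qed.

Lemma circ_tensA m n p m' n' p' (f : circuit_cls m m') (g : circuit_cls n n')
    (h : circuit_cls p p') :
  hcast (addnA m n p) (addnA m' n' p') (circ_tens f (circ_tens g h)) =
  circ_tens (circ_tens f g) h.
Proof.
have [[c ->] [d ->]] := (circW f, circW g); have [e ->] := circW h.
rewrite !circ_tensE circ_hcastE; apply: eq_ccls => /=.
pose F A B C (x : A + (B + C)) : (A + B) + C := match x with
  | inl y => inl (inl y) | inr (inl y) => inl (inr y) | inr (inr y) => inr y end.
have bF A B C : bijective (@F A B C).
  by exists (fun x => match x with
    | inl (inl y) => inl y | inl (inr y) => inr (inl y) | inr y => inr (inr y) end)
    => [[|[]]|[[]|]].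
exists (@F _ _ _), (@F _ _ _); split; split=> //=.
- move=> i; rewrite split_castA.
  case: (split i) => [j|a] /=; last by rewrite splitR.
  by case: (split j) => a /=; rewrite ?splitL ?splitR.
- move=> i; rewrite split_castA.
  case: (split i) => [j|a] /=; last by rewrite splitR.
  by case: (split j) => a /=; rewrite ?splitL ?splitR.
- by move=> [|[]].
- by move=> [|[]].
- by move=> [|[]].
Qed.

Lemma split_cast0n n (i : 'I_n) : split (cast_ord (esym (add0n n)) i) = inr i.
Proof. rewrite -[RHS]unsplitK; congr split; exact: val_inj. Qed.

Lemma split_castn0 n (i : 'I_n) : split (cast_ord (esym (addn0 n)) i) = inl i.
Proof. rewrite -[RHS]unsplitK; congr split; exact: val_inj. Qed.

Lemma circ_tens0f m n (f : circuit_cls m n) :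
  hcast (add0n m) (add0n n) (circ_tens (circ_id 0) f) = f.
Proof.
have [c ->] := circW f; rewrite circ_tensE circ_hcastE; apply/esym/eq_ccls => /=.
exists inr, inr; split; split=> //=.
- exists (fun x : 'I_0 + apex c => match x with inl (Ordinal _ H) => False_rect _ (notF H) | inr y => y end) => //.
  by move=> [[]|].
- by move=> i; rewrite split_cast0n.
- by move=> i; rewrite split_cast0n.
- by exists (fun x : void + edges c => match x with inl v => of_void _ v | inr y => y end) => // -[[]|].
Qed.

Lemma circ_tensf0 m n (f : circuit_cls m n) :
  hcast (addn0 m) (addn0 n) (circ_tens f (circ_id 0)) = f.
Proof.
have [c ->] := circW f; rewrite circ_tensE circ_hcastE; apply/esym/eq_ccls => /=.
exists inl, inl; split; split=> //=.
- exists (fun x : apex c + 'I_0 => match x with inr (Ordinal _ H) => False_rect _ (notF H) | inl y => y end) => //.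
  by move=> [|[]].
- by move=> i; rewrite split_castn0.
- by move=> i; rewrite split_castn0.
- by exists (fun x : edges c + void => match x with inr v => of_void _ v | inl y => y end) => // -[|[]].
Qed.

Lemma circ_sym_nat m n m' n' (f : circuit_cls m m') (g : circuit_cls n n') :
  circ_comp (circ_tens f g) (circ_sym m' n') = circ_comp (circ_sym m n) (circ_tens g f).
Proof.
have [[c ->] [d ->]] := (circW f, circW g).
rewrite !circ_symE !circ_tensE circ_comp_graph (circ_graph_comp _ (@ord_swapK _ _) (@ord_swapK _ _)).
apply: eq_ccls; exists (@sum_swap _ _), (@sum_swap _ _); split; split=> //=; try exact: bij_sum_swap.
- by move=> i; rewrite /ord_swap unsplitK; case: (split i).
- by move=> i; rewrite /ord_swap unsplitK; case: (split i).
- by move=> [].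
- by move=> [].
- by move=> [].
Qed.

Lemma circ_symK m n : circ_comp (circ_sym m n) (circ_sym n m) = circ_id (m + n).
Proof.
by rewrite circ_graph_comp_graph; congr graph; apply/funext => i; rewrite /= ord_swapK.
Qed.

Lemma circ_sym_hex m n p :
  circ_sym m (n + p) =
  hcast (esym (addnA m n p)) (addnA n p m)
    (circ_comp (hcast erefl (esym (addnA n m p)) (circ_tens (circ_sym m n) (circ_id p)))
               (circ_tens (circ_id n) (circ_sym m p))).
Proof.
rewrite !circ_symE !circ_idE !circ_tens_graph.
rewrite !hcast_graph circ_graph_comp_graph hcast_graph.
congr graph; apply/funext => i /=; rewrite cast_ord_id.
case: (split_ordP i) => [j ->|c ->]; first case: (split_ordP j) => [a ->|b ->];
  rewrite !(cast_shift, ord_sumL, ord_sumR, ord_swapL, ord_swapR) //.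
Qed.

End Circuit.

Definition Circ (L : Type) : prop :=
  @MkProp (circuit_cls L) (@circ_id L) (@circ_comp L) (@circ_tens L) (@circ_sym L)
    (@circ_compA L) (@circ_comp1f L) (@circ_compf1 L) (@circ_tens11 L)
    (@circ_tens_comp L) (@circ_tensA L) (@circ_tens0f L) (@circ_tensf0 L)
    (@circ_sym_nat L) (@circ_symK L) (@circ_sym_hex L).

Definition circ_edge (L : Type) (l : L) : hom (Circ L) 1 1 := cls _ (circuit_edge l).

(* The prop axioms of FinCospan are transported from circuits along the
   inclusion of cospans as the circuits without edges.                  *)

Definition fincospan_id n : cospan_cls n n := cls _ (cospan_id n).
Definition fincospan_comp m n p (x : cospan_cls m n) (y : cospan_cls n p) :
  cospan_cls m p := cls _ (cospan_comp (qrepr x) (qrepr y)).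
Definition fincospan_tens m n p q (x : cospan_cls m n) (y : cospan_cls p q) :
  cospan_cls (m + p) (n + q) := cls _ (cospan_tens (qrepr x) (qrepr y)).
Definition fincospan_sym m n : cospan_cls (m + n) (n + m) := cls _ (cospan_sym m n).

Definition circ_of_cospan L m n (x : cospan_cls m n) : circuit_cls L m n :=
  cls _ (circuit_of_cospan L (qrepr x)).

Lemma cospan_iso_refl m n (c : cospan m n) : cospan_iso c c.
Proof. by exists id; split=> //; exists id. Qed.

Lemma cospan_isoP L m n (c d : cospan m n) :
  cospan_iso c d <-> circuit_iso (circuit_of_cospan L c) (circuit_of_cospan L d).
Proof.
split=> [[h [hb hl hr]]|[h [_ [[hb hl hr] _]]]]; last by exists h.
by exists h, id; split; split=> //; exists id.
Qed.

Lemma cospan_iso_sym m n (c d : cospan m n) : cospan_iso c d -> cospan_iso d c.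
Proof. by move=> /(@cospan_isoP unit)/circuit_iso_sym/cospan_isoP. Qed.

Lemma cospan_iso_trans m n (c d e : cospan m n) :
  cospan_iso c d -> cospan_iso d e -> cospan_iso c e.
Proof.
move=> /(@cospan_isoP unit) cd /(@cospan_isoP unit) de.
by apply/(@cospan_isoP unit)/(circuit_iso_trans cd de).
Qed.

Lemma eq_cospan_cls m n (c d : cospan m n) :
  cospan_iso c d -> cls (@cospan_iso m n) c = cls _ d.
Proof. exact: eq_cls (@cospan_iso_sym m n) (@cospan_iso_trans m n) _ _. Qed.

Lemma cospan_cls_eq m n (c d : cospan m n) :
  cls (@cospan_iso m n) c = cls _ d -> cospan_iso c d.
Proof. exact: cls_eq (@cospan_iso_refl m n) _ _. Qed.

Lemma repr_cospan m n (c : cospan m n) : cospan_iso c (qrepr (cls (@cospan_iso m n) c)).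
Proof. exact: repr_cls (@cospan_iso_refl m n) c. Qed.

Section Inclusion.
Variable L : Type.
Local Notation incl := (@circ_of_cospan L _ _).

Lemma circ_of_cospanE m n (c : cospan m n) :
  incl (cls _ c) = cls _ (circuit_of_cospan L c).
Proof. by apply/eq_ccls/circuit_iso_sym/cospan_isoP/repr_cospan. Qed.

Lemma circ_of_cospan_inj m n : injective (@circ_of_cospan L m n).
Proof.
move=> x y; rewrite -(qreprK x) -(qreprK y) !circ_of_cospanE => /ccls_eq/cospan_isoP.
exact: eq_cospan_cls.
Qed.

Lemma circ_of_cospan_id n : incl (fincospan_id n) = circ_id L n.
Proof. exact: circ_of_cospanE. Qed.

Lemma circ_of_cospan_sym m n : incl (fincospan_sym m n) = circ_sym L m n.
Proof. exact: circ_of_cospanE. Qed.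

Lemma circ_of_cospan_comp m n p (x : cospan_cls m n) (y : cospan_cls n p) :
  incl (fincospan_comp x y) = circ_comp (incl x) (incl y).
Proof.
rewrite circ_of_cospanE.
rewrite (@circ_comp_po _ _ _ _ (circuit_of_cospan L (qrepr x)) (circuit_of_cospan L (qrepr y))
  _ _ _ (pushoutP _ _)).
apply: eq_ccls; exists id, inl; split; split=> //; try by case.
  by exists id.
by exists (fun v => match v with inl v => v | inr v => v end) => -[] // [].
Qed.

Lemma circ_of_cospan_tens m n p q (x : cospan_cls m n) (y : cospan_cls p q) :
  incl (fincospan_tens x y) = circ_tens (incl x) (incl y).
Proof.
rewrite circ_of_cospanE circ_tensE.
apply: eq_ccls; exists id, inl; split; split=> //; try by case.
  by exists id.
by exists (fun v => match v with inl v => v | inr v => v end) => -[] // [].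
Qed.

Lemma circ_of_cospan_hcast m m' n n' (em : m = m') (en : n = n') (x : cospan_cls m n) :
  incl (hcast em en x) = hcast em en (incl x).
Proof. by case: m' / em; case: n' / en. Qed.

End Inclusion.

Definition circ_of_cospan_morph := (circ_of_cospan_hcast, circ_of_cospan_id,
  circ_of_cospan_sym, circ_of_cospan_comp, circ_of_cospan_tens).

Definition FinCospan : prop.
Proof.
refine (@MkProp cospan_cls fincospan_id fincospan_comp fincospan_tens fincospan_sym
  _ _ _ _ _ _ _ _ _ _ _); move=> *; apply: (@circ_of_cospan_inj void); rewrite !circ_of_cospan_morph.
- exact: circ_compA.
- exact: circ_comp1f.
- exact: circ_compf1.
- exact: circ_tens11.
- exact: circ_tens_comp.
- exact: circ_tensA.
- exact: circ_tens0f.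
- exact: circ_tensf0.
- exact: circ_sym_nat.
- exact: circ_symK.
- exact: circ_sym_hex.
Defined.

Definition cospan_to_circ (L : Type) : prop_mor FinCospan (Circ L) :=
  @PropMor FinCospan (Circ L) (@circ_of_cospan L) (@circ_of_cospan_id L)
    (@circ_of_cospan_comp L) (@circ_of_cospan_tens L) (@circ_of_cospan_sym L).

Definition jointly_epic m n (c : cospan m n) : Prop :=
  forall s : apex c, (exists i, lleg c i = s) \/ (exists j, rleg c j = s).

Definition corel (m n : nat) : Type :=
  {x : cospan_cls m n | exists2 c, x = cls _ c & jointly_epic c}.

(* Restriction of the apex to the union of the images of the legs. *)
Section Restrict.
Variables (m n : nat) (c : cospan m n).

Definition leg_image : finType :=
  {s : apex c | (s \in codom (lleg c)) || (s \in codom (rleg c))}.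

Lemma lleg_image i : (lleg c i \in codom (lleg c)) || (lleg c i \in codom (rleg c)).
Proof. by rewrite codom_f. Qed.

Lemma rleg_image j : (rleg c j \in codom (lleg c)) || (rleg c j \in codom (rleg c)).
Proof. by rewrite codom_f orbT. Qed.

Definition cospan_restrict : cospan m n :=
  @Cospan m n leg_image (fun i => exist _ (lleg c i) (lleg_image i))
    (fun j => exist _ (rleg c j) (rleg_image j)).

Lemma cospan_restrict_epic : jointly_epic cospan_restrict.
Proof.
move=> [s sP]; case/orP: (sP) => /codomP[i e]; [left|right]; exists i;
  exact/val_inj/esym.
Qed.

End Restrict.

Definition corel_of_cospan m n (x : cospan_cls m n) : corel m n :=
  exist _ (cls _ (cospan_restrict (qrepr x)))
    (ex_intro2 _ _ _ erefl (@cospan_restrict_epic m n (qrepr x))).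

Definition corel_comp m n p (x : corel m n) (y : corel n p) : corel m p :=
  corel_of_cospan (fincospan_comp (sval x) (sval y)).

Lemma cospan_tens_epic m n p q (c : cospan m n) (d : cospan p q) :
  jointly_epic c -> jointly_epic d -> jointly_epic (cospan_tens c d).
Proof.
by move=> ec ed [s|s]; [case: (ec s)|case: (ed s)] => -[i <-]; [left|right|left|right];
  [exists (lshift _ i)|exists (lshift _ i)|exists (rshift _ i)|exists (rshift _ i)];
  rewrite /= ?splitL ?splitR.
Qed.

Lemma jointly_epic_iso m n (c d : cospan m n) :
  cospan_iso c d -> jointly_epic c -> jointly_epic d.
Proof.
move=> [h [[k hK kK] hl hr]] ec s.
case: (ec (k s)) => -[i ei]; [left|right]; exists i; by rewrite -?hl -?hr ei kK.
Qed.

Lemma corel_repr_epic m n (x : corel m n) : jointly_epic (qrepr (sval x)).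
Proof.
case: x => _ /= [c -> ec]; exact: jointly_epic_iso (repr_cospan c) ec.
Qed.

Definition corel_tens m n p q (x : corel m n) (y : corel p q) : corel (m + p) (n + q) :=
  exist _ (fincospan_tens (sval x) (sval y))
    (ex_intro2 _ _ _ erefl (cospan_tens_epic (@corel_repr_epic _ _ x) (@corel_repr_epic _ _ y))).

Lemma cospan_id_epic n : jointly_epic (cospan_id n).
Proof. by move=> s; left; exists s. Qed.

Lemma cospan_sym_epic m n : jointly_epic (cospan_sym m n).
Proof. by move=> s; left; exists s. Qed.

Definition corel_id n : corel n n :=
  exist _ (fincospan_id n) (ex_intro2 _ _ _ erefl (@cospan_id_epic n)).

Definition corel_sym m n : corel (m + n) (n + m) :=
  exist _ (fincospan_sym m n) (ex_intro2 _ _ _ erefl (@cospan_sym_epic m n)).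

Section CorelTheory.

Definition leg m n (c : cospan m n) (x : 'I_m + 'I_n) : apex c :=
  match x with inl i => lleg c i | inr j => rleg c j end.

Definition same_ker m n (c d : cospan m n) : Prop :=
  forall x y, (leg c x = leg c y) <-> (leg d x = leg d y).

Lemma epic_leg m n (c : cospan m n) : jointly_epic c -> forall s, exists x, leg c x = s.
Proof. by move=> ec s; case: (ec s) => -[i <-]; [exists (inl i)|exists (inr i)]. Qed.

Lemma same_ker_iso m n (c d : cospan m n) :
  jointly_epic c -> jointly_epic d -> same_ker c d -> cospan_iso c d.
Proof.
move=> ec ed cd.
pose f s := sval (cid (epic_leg ec s)); pose g s := sval (cid (epic_leg ed s)).
have fK s : leg c (f s) = s by rewrite /f; case: cid.
have gK s : leg d (g s) = s by rewrite /g; case: cid.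
have hE x : leg d (f (leg c x)) = leg d x by apply/cd.
exists (leg d \o f); split.
- exists (leg c \o g) => s /=; last by rewrite -[RHS]gK; apply/cd; rewrite fK.
  by rewrite -[RHS]fK; apply/cd; rewrite gK.
- by move=> i; rewrite -[RHS](hE (inl i)).
- by move=> i; rewrite -[RHS](hE (inr i)).
Qed.

Lemma same_ker_restrict m n (c : cospan m n) : same_ker (cospan_restrict c) c.
Proof.
have E z : val (leg (cospan_restrict c) z) = leg c z by case: z.
by move=> x y; rewrite -!E; split=> [->|/val_inj].
Qed.

Lemma same_ker_trans m n (c d e : cospan m n) :
  same_ker c d -> same_ker d e -> same_ker c e.
Proof. by move=> cd de x y; split=> [/cd/de|/de/cd]. Qed.

Lemma same_ker_sym m n (c d : cospan m n) : same_ker c d -> same_ker d c.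
Proof. by move=> cd x y; split=> /cd. Qed.

Lemma same_ker_mono m n (c d : cospan m n) (h : apex c -> apex d) : injective h ->
  (forall i, h (lleg c i) = lleg d i) -> (forall i, h (rleg c i) = rleg d i) -> same_ker c d.
Proof.
move=> hi hl hr; have E z : h (leg c z) = leg d z by case: z.
by move=> x y; rewrite -!E; split=> [->|/hi].
Qed.

Lemma iso_same_ker m n (c d : cospan m n) : cospan_iso c d -> same_ker c d.
Proof. by move=> [h [hb hl hr]]; apply: same_ker_mono hl hr; apply: bij_inj. Qed.

Lemma corel_inj m n (x y : corel m n) : sval x = sval y -> x = y.
Proof. by case: x y => [x px] [y py] /= e; apply: eq_exist. Qed.

Lemma corel_of_cospan_eq m n (c d : cospan m n) : same_ker c d ->
  corel_of_cospan (cls _ c) = corel_of_cospan (cls _ d).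
Proof.
move=> cd; apply: corel_inj; apply: eq_cospan_cls.
apply: same_ker_iso; try exact: cospan_restrict_epic.
apply: same_ker_trans (same_ker_restrict _) _.
apply: same_ker_trans (same_ker_sym (iso_same_ker (repr_cospan c))) _.
apply: same_ker_trans cd _; apply: same_ker_sym.
apply: same_ker_trans (same_ker_restrict _) _.
exact: same_ker_sym (iso_same_ker (repr_cospan d)).
Qed.

Lemma corel_of_cospanK m n (x : corel m n) : corel_of_cospan (sval x) = x.
Proof.
apply: corel_inj; rewrite /= -[RHS]qreprK; apply: eq_cospan_cls.
apply: same_ker_iso; [exact: cospan_restrict_epic|exact: corel_repr_epic|].
exact: same_ker_restrict.
Qed.

Lemma corel_of_cospan_comp m n p (x : cospan_cls m n) (y : cospan_cls n p) :
  corel_of_cospan (fincospan_comp x y) =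
  corel_comp (corel_of_cospan x) (corel_of_cospan y).
Proof.
rewrite /corel_comp [in RHS]/fincospan_comp /=.
set c := qrepr x; set d := qrepr y.
have [h [hb hl hr]] := repr_cospan (cospan_restrict c).
have [k [kb kl kr]] := repr_cospan (cospan_restrict d).
move: (qrepr _) (qrepr _) h hb hl hr k kb kl kr => d' c' h hb hl hr k kb kl kr.
apply: esym; apply: corel_of_cospan_eq.
case: hb kb => [h' hK hK'] [k' kK kK'].
have e1 i : val (h' (rleg c' i)) = rleg c i by rewrite -hr hK.
have e2 i : val (k' (lleg d' i)) = lleg d i by rewrite -kl kK.
have [ab j u] := pushoutP (rleg c) (lleg d).
have [ab' j' u'] := pushoutP (rleg c') (lleg d').
have [|r [rl rr]] := u' _ (po_inl (rleg c) (lleg d) \o val \o h')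
                         (po_inr (rleg c) (lleg d) \o val \o k').
  by move=> i /=; rewrite e1 e2 ab.
pose tc s := omap (po_inl (rleg c') (lleg d') \o h)
  (insub s : option (leg_image c)).
pose td s := omap (po_inr (rleg c') (lleg d') \o k)
  (insub s : option (leg_image d)).
have tcE (s : leg_image c) : tc (val s) = Some (po_inl (rleg c') (lleg d') (h s)).
  by rewrite /tc valK.
have tdE (s : leg_image d) : td (val s) = Some (po_inr (rleg c') (lleg d') (k s)).
  by rewrite /td valK.
have [|w [wl wr]] := u _ tc td.
  by move=> i; rewrite -e1 -e2 tcE tdE hK' kK' ab'.
have rK s : w (r s) = Some s.
  case: (j' s) => -[t ->]; rewrite ?rl ?rr /= ?wl ?wr ?tcE ?tdE ?hK' ?kK' //.
have r_inj : injective r by move=> s t /(congr1 w); rewrite !rK => -[].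
apply: (@same_ker_mono _ _ (cospan_comp c' d') (cospan_comp c d) r r_inj) => i /=.
  by rewrite rl /= -hl hK.
by rewrite rr /= -kr kK.
Qed.

Lemma corel_of_cospan_tens m n p q (x : cospan_cls m n) (y : cospan_cls p q) :
  corel_of_cospan (fincospan_tens x y) =
  corel_tens (corel_of_cospan x) (corel_of_cospan y).
Proof.
rewrite -[RHS]corel_of_cospanK /=; apply: esym; apply: corel_of_cospan_eq.
set c := qrepr x; set d := qrepr y.
have [h [hb hl hr]] := repr_cospan (cospan_restrict c).
have [k [kb kl kr]] := repr_cospan (cospan_restrict d).
move: (qrepr _) (qrepr _) h hb hl hr k kb kl kr => d' c' h hb hl hr k kb kl kr.
case: hb kb => [h' hK hK'] [k' kK kK'].
apply: (@same_ker_mono _ _ (cospan_tens c' d') (cospan_tens c d)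
  (sum_map (val \o h') (val \o k'))).
- by move=> [s|s] [t|t] //= [] /val_inj; [move/(can_inj hK')|move/(can_inj kK')] => ->.
- by move=> i /=; case: (split i) => a /=; rewrite -?hl -?kl ?hK ?kK.
- by move=> i /=; case: (split i) => a /=; rewrite -?hr -?kr ?hK ?kK.
Qed.

Lemma corel_of_cospan_id n : corel_of_cospan (fincospan_id n) = corel_id n.
Proof. exact: (corel_of_cospanK (corel_id n)). Qed.

Lemma corel_of_cospan_sym m n : corel_of_cospan (fincospan_sym m n) = corel_sym m n.
Proof. exact: (corel_of_cospanK (corel_sym m n)). Qed.

Lemma corel_of_cospan_hcast m m' n n' (em : m = m') (en : n = n') (x : cospan_cls m n) :
  corel_of_cospan (hcast em en x) = hcast em en (corel_of_cospan x).
Proof. by case: m' / em; case: n' / en. Qed.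

Lemma corelW m n (x : corel m n) : exists y, x = corel_of_cospan y.
Proof. by exists (sval x); rewrite corel_of_cospanK. Qed.

End CorelTheory.

Definition corel_of_cospan_morph := (corel_of_cospan_hcast, corel_of_cospan_id,
  corel_of_cospan_sym, corel_of_cospan_comp, corel_of_cospan_tens).

Definition FinCorel : prop.
Proof.
refine (@MkProp corel corel_id corel_comp corel_tens corel_sym
  _ _ _ _ _ _ _ _ _ _ _).
- move=> m n p q f g h.
  have [[x ->] [y ->] [z ->]] := And3 (corelW f) (corelW g) (corelW h).
  by rewrite -!corel_of_cospan_morph; congr corel_of_cospan; apply: (@prop_compA FinCospan).
- move=> m n f; have [x ->] := corelW f.
  by rewrite -!corel_of_cospan_morph; congr corel_of_cospan; apply: (@prop_comp1f FinCospan).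
- move=> m n f; have [x ->] := corelW f.
  by rewrite -!corel_of_cospan_morph; congr corel_of_cospan; apply: (@prop_compf1 FinCospan).
- by move=> m n; rewrite -!corel_of_cospan_morph; congr corel_of_cospan; apply: (@prop_tens11 FinCospan).
- move=> m n p m' n' p' f g f' g'.
  have [[x ->] [y ->] [z ->]] := And3 (corelW f) (corelW g) (corelW f').
  have [w ->] := corelW g'.
  by rewrite -!corel_of_cospan_morph; congr corel_of_cospan; apply: (@prop_tens_comp FinCospan).
- move=> m n p m' n' p' f g h.
  have [[x ->] [y ->] [z ->]] := And3 (corelW f) (corelW g) (corelW h).
  by rewrite -!corel_of_cospan_morph; congr corel_of_cospan; apply: (@prop_tensA FinCospan).
- move=> m n f; have [x ->] := corelW f.
  by rewrite -!corel_of_cospan_morph; congr corel_of_cospan; apply: (@prop_tens0f FinCospan).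
- move=> m n f; have [x ->] := corelW f.
  by rewrite -!corel_of_cospan_morph; congr corel_of_cospan; apply: (@prop_tensf0 FinCospan).
- move=> m n m' n' f g; have [[x ->] [y ->]] := (corelW f, corelW g).
  by rewrite -!corel_of_cospan_morph; congr corel_of_cospan; apply: (@prop_sym_nat FinCospan).
- by move=> m n; rewrite -!corel_of_cospan_morph; congr corel_of_cospan; apply: (@prop_symK FinCospan).
- by move=> m n p; rewrite -!corel_of_cospan_morph; congr corel_of_cospan; apply: (@prop_sym_hex FinCospan).
Defined.

Definition H_mor : prop_mor FinCospan FinCorel :=
  @PropMor FinCospan FinCorel corel_of_cospan corel_of_cospan_id
    corel_of_cospan_comp corel_of_cospan_tens corel_of_cospan_sym.

Definition one_block_cospan m n : cospan m n :=
  @Cospan m n unit (fun _ => tt) (fun _ => tt).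

Lemma one_block_epic m n : 0 < m + n -> jointly_epic (one_block_cospan m n).
Proof.
case: m => [|m] mn [].
  by right; case: n mn => // n _; exists ord0.
by left; exists ord0.
Qed.

Definition one_block m n (mn : 0 < m + n) : hom FinCorel m n :=
  exist _ (cls _ (one_block_cospan m n)) (ex_intro2 _ _ _ erefl (one_block_epic mn)).

Local Open Scope ring_scope.

Section Lagrangian.
Variables (k : fieldType) (V : vectType k) (w : V -> V -> k).

Definition isotropic (L : {vspace V}) : Prop :=
  forall x y, x \in L -> y \in L -> w x y = 0.

Definition lagrangian (L : {vspace V}) : Prop :=
  isotropic L /\ forall M : {vspace V}, isotropic M -> (L <= M)%VS -> M = L.

Record symplectic : Prop := Symplectic {
  sympl_linear_l : forall a x y z, w (a *: x + y) z = a * w x z + w y z;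
  sympl_linear_r : forall a x y z, w x (a *: y + z) = a * w x y + w x z;
  sympl_alternating : forall x, w x x = 0;
  sympl_nondegenerate : forall x, (forall y, w x y = 0) -> x = 0
}.

Hypothesis sw : symplectic.

Lemma sympl_anti x y : w x y = - w y x.
Proof.
case: sw => wl wr wa _; apply/eqP; rewrite -addr_eq0; apply/eqP.
have := wa (1 *: x + y); rewrite wl !wr !wa !mul1r addr0 add0r => e.
by rewrite -[RHS]e.
Qed.

Lemma lagrangianP (L : {vspace V}) :
  lagrangian L <->
  isotropic L /\ forall x, (forall y, y \in L -> w x y = 0) -> x \in L.
Proof.
case: (sw) => wl wr wa _; split=> -[iso mx]; split=> //.
  move=> x xL; rewrite -(mx (L + <[x]>)%VS _ (addvSl _ _)).
    by apply/(subvP (addvSr _ _)); rewrite memv_line.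
  move=> _ _ /memv_addP[u uL [v /vlineP[a ->] ->]] /memv_addP[u' uL' [v' /vlineP[b ->] ->]].
  rewrite [u + _]addrC [u' + _]addrC wl !wr wa (xL _ uL') (iso _ _ uL uL').
  by rewrite [w u x]sympl_anti (xL _ uL) oppr0 !(mulr0, addr0).
move=> M iM LM; apply/eqP; rewrite eqEsubv LM andbT; apply/subvP => x xM.
by apply: mx => y yL; apply: iM => //; apply: (subvP LM).
Qed.

End Lagrangian.

Section LinearRelations.
Variable k : fieldType.

(* (k + k)^n; a vector assigns to i < n a potential (v i).1 and a current (v i).2 *)
Definition pc (n : nat) : vectType k := {ffun 'I_n -> (k^o * k^o)%type}.

Definition omega1 (x y : (k^o * k^o)%type) : k := x.1 * y.2 - y.1 * x.2.

Definition omega n (x y : pc n) : k := \sum_i omega1 (x i) (y i).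

(* The form of the direct sum of the conjugate of (k + k)^m with (k + k)^n. *)
Definition rel_omega m n (x y : (pc m * pc n)%type) : k :=
  - omega x.1 y.1 + omega x.2 y.2.

Lemma omega_symplectic n : symplectic (@omega n).
Proof.
have sE (a : k) (b : k^o) : a *: b = a * b by [].
split.
- move=> a x y z; rewrite /omega mulr_sumr -big_split; apply: eq_bigr => i _ /=.
  rewrite /omega1 !ffunE /= !sE; ring.
- move=> a x y z; rewrite /omega mulr_sumr -big_split; apply: eq_bigr => i _ /=.
  rewrite /omega1 !ffunE /= !sE; ring.
- by move=> x; rewrite /omega big1 // => i _; rewrite /omega1 subrr.
- move=> x hx; apply/ffunP => i; rewrite ffunE.
  have d a b j : (i != j) -> omega1 (x j) ([ffun l => if l == i then (a, b) else 0] j) = 0.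
    by move=> ij; rewrite ffunE eq_sym (negPf ij) /omega1 /= mulr0 mul0r subrr.
  have /= := hx [ffun l => if l == i then (0, 1) else 0].
  rewrite /omega (bigD1 i) //= big1 => [|j ji]; last by rewrite d // eq_sym.
  rewrite ffunE eqxx /omega1 /= mulr1 mul0r subr0 addr0.
  have /= := hx [ffun l => if l == i then (1, 0) else 0].
  rewrite /omega (bigD1 i) //= big1 => [|j ji]; last by rewrite d // eq_sym.
  rewrite ffunE eqxx /omega1 /= mulr0 mul1r sub0r addr0 => /eqP; rewrite oppr_eq0.
  by case: (x i) => a b /= /eqP -> ->.
Qed.

Lemma omega_linear_l n a (x y z : pc n) : omega (a *: x + y) z = a * omega x z + omega y z.
Proof. exact: sympl_linear_l (omega_symplectic n) _ _ _ _. Qed.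

Lemma omega_linear_r n a (x y z : pc n) : omega x (a *: y + z) = a * omega x y + omega x z.
Proof. exact: sympl_linear_r (omega_symplectic n) _ _ _ _. Qed.

Lemma omega0l n (x : pc n) : omega 0 x = 0.
Proof. by have := omega_linear_l (-1) x x x; rewrite scaleN1r addNr mulN1r addNr. Qed.

Lemma omega0r n (x : pc n) : omega x 0 = 0.
Proof. by have := omega_linear_r (-1) x x x; rewrite scaleN1r addNr mulN1r addNr. Qed.

Lemma omegaC n (x y : pc n) : omega x y = - omega y x.
Proof. exact: sympl_anti (omega_symplectic n) _ _. Qed.

Lemma omegaBl n (x y z : pc n) : omega (x - y) z = omega x z - omega y z.
Proof. by rewrite addrC -scaleN1r omega_linear_l mulN1r addrC. Qed.

Lemma omega_inj n (x y : pc n) : (forall z, omega x z = omega y z) -> x = y.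
Proof.
move=> e; apply/eqP; rewrite -subr_eq0; apply/eqP.
by apply: (sympl_nondegenerate (omega_symplectic n)) => z; rewrite omegaBl e subrr.
Qed.

Lemma rel_omega_symplectic m n : symplectic (@rel_omega m n).
Proof.
split.
- move=> a x y z; rewrite /rel_omega /= !omega_linear_l mulrDr mulrN opprD.
  by rewrite addrACA.
- move=> a x y z; rewrite /rel_omega /= !omega_linear_r mulrDr mulrN opprD.
  by rewrite addrACA.
- move=> x; rewrite /rel_omega !(sympl_alternating (omega_symplectic _)).
  by rewrite oppr0 addr0.
- move=> [x y] h; congr pair.
    apply: (sympl_nondegenerate (omega_symplectic m)) => z.
    by have /eqP := h (z, 0); rewrite /rel_omega /= omega0r addr0 oppr_eq0 => /eqP.
  apply: (sympl_nondegenerate (omega_symplectic n)) => z.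
  by have := h (0, z); rewrite /rel_omega /= omega0r oppr0 add0r.
Qed.

Definition lagrel (m n : nat) : Type :=
  {L : {vspace pc m * pc n} | lagrangian (@rel_omega m n) L}.

Definition related m n (L : lagrel m n) (x : pc m) (y : pc n) : bool := (x, y) \in sval L.

Lemma lagrel_inj m n (L M : lagrel m n) :
  (forall x y, related L x y = related M x y) -> L = M.
Proof.
case: L M => [L hL] [M hM] /= e; apply: eq_exist.
by apply/vspaceP => -[x y]; apply: e.
Qed.

Lemma mk_lagrangian m n (L : {vspace pc m * pc n}) :
  (forall x y, x \in L -> y \in L -> rel_omega x y = 0) ->
  (forall x, (forall y, y \in L -> rel_omega x y = 0) -> x \in L) ->
  lagrangian (@rel_omega m n) L.
Proof. by move=> h1 h2; apply/(lagrangianP (@rel_omega_symplectic m n)). Qed.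

Lemma lagrel_isotropic m n (L : lagrel m n) x y x' y' :
  related L x y -> related L x' y' -> omega x x' = omega y y'.
Proof.
move=> h h'; case: (svalP L) => iL _.
by have /eqP := iL _ _ h h'; rewrite /rel_omega /= addrC subr_eq0 => /eqP ->.
Qed.

Lemma lagrel_max m n (L : lagrel m n) x y :
  (forall x' y', related L x' y' -> omega x x' = omega y y') -> related L x y.
Proof.
move=> h; have /(lagrangianP (@rel_omega_symplectic m n))[_] := svalP L; apply.
by move=> [x' y'] /h e; rewrite /rel_omega /= e addNr.
Qed.

Lemma omega_represents n (f : {linear pc n -> k^o}) : exists v, forall x, f x = omega v x.
Proof.
pose e i (a : k^o * k^o) : pc n := [ffun j => if j == i then a else 0].
exists [ffun i => (f (e i (0, 1)), - f (e i (1, 0)))] => x.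
have {1}-> : x = \sum_i ((x i).1 *: e i (1, 0) + (x i).2 *: e i (0, 1)).
  apply/ffunP => j; rewrite sum_ffunE (bigD1 j) //= big1 => [|i ij].
    rewrite !ffunE eqxx addr0; case: (x j) => a b /=. 
    have -> : a *: (1 : k^o, 0 : k^o) = (a, 0) by congr pair; [apply: mulr1|apply: mulr0].
    have -> : b *: (0 : k^o, 1 : k^o) = (0, b) by congr pair; [apply: mulr0|apply: mulr1].
    by congr pair; rewrite /= ?addr0 ?add0r.
  by rewrite !ffunE eq_sym (negPf ij) !scaler0 addr0.
rewrite linear_sum; apply: eq_bigr => i _; rewrite linearD !linearZ ffunE /omega1 /=.
by rewrite mulrN opprK addrC [X in X + _]mulrC.
Qed.

Lemma factor_functional (W V : vectType k) (X : {vspace W})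
    (d : 'Hom(W, V)) (f : {linear W -> k^o}) :
  (forall x, x \in X -> d x = 0 -> f x = 0) ->
  exists g : {linear V -> k^o}, forall x, x \in X -> f x = g (d x).
Proof.
move=> h; pose d' := (d \o projv X)%VF.
exists (linfun f \o projv X \o d'^-1)%VF => x xX /=.
have e : d x = d' x by rewrite lfunE /= projv_id.
rewrite !lfunE /= !lfunE /=; set z := projv X _.
have zX : z \in X by apply: memv_proj.
have ez : d z = d x.
  have -> : d z = d' (d'^-1%VF (d x)) by rewrite [in RHS]lfunE /=.
  by rewrite limg_lfunVK // e memv_img // memvf.
have /eqP : f (x - z) = 0 by apply: h; [exact: memvB|rewrite linearB /= ez subrr].
by rewrite linearB subr_eq0 lfunE => /eqP.
Qed.

Section Comp.
Variables (m n p : nat).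
Let Z := ((pc m * pc n) * pc p)%type.

Definition proj12 (z : Z) : (pc m * pc n)%type := z.1.
Definition proj23 (z : Z) : (pc n * pc p)%type := (z.1.2, z.2).
Definition proj13 (z : Z) : (pc m * pc p)%type := (z.1.1, z.2).

Lemma proj12_linear : linear proj12. Proof. by []. Qed.
Lemma proj23_linear : linear proj23. Proof. by []. Qed.
Lemma proj13_linear : linear proj13. Proof. by []. Qed.
HB.instance Definition _ := GRing.isLinear.Build k Z _ _ proj12 proj12_linear.
HB.instance Definition _ := GRing.isLinear.Build k Z _ _ proj23 proj23_linear.
HB.instance Definition _ := GRing.isLinear.Build k Z _ _ proj13 proj13_linear.

Definition rel_comp (L : {vspace pc m * pc n}) (M : {vspace pc n * pc p}) :
  {vspace pc m * pc p} :=
  (linfun proj13 @: (linfun proj12 @^-1: L :&: linfun proj23 @^-1: M))%VS.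

Lemma rel_compP (L : {vspace pc m * pc n}) (M : {vspace pc n * pc p}) x z :
  reflect (exists2 y, (x, y) \in L & (y, z) \in M) ((x, z) \in rel_comp L M).
Proof.
apply: (iffP memv_imgP) => [[[[x' y] z']]|[y xy yz]].
  by rewrite memv_cap -!memv_preim !lfunE /= => /andP[h1 h2] [-> ->]; exists y.
by exists (x, y, z); rewrite ?lfunE // memv_cap -!memv_preim !lfunE; apply/andP.
Qed.

End Comp.

Lemma rel_comp_lagrangian m n p (L : lagrel m n) (M : lagrel n p) :
  lagrangian (@rel_omega m p) (rel_comp (sval L) (sval M)).
Proof.
apply: mk_lagrangian.
  move=> [x z] [x' z'] /rel_compP[y xy yz] /rel_compP[y' xy' yz'].
  by rewrite /rel_omega /= (lagrel_isotropic xy xy') (lagrel_isotropic yz yz') addNr.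
move=> [x z] h.
pose W := ((pc m * pc n) * (pc n * pc p))%type.
pose d (u : W) : pc n := u.1.2 - u.2.1.
have d_lin : linear d.
  by move=> a u v; rewrite /d /= scalerBr opprD addrACA.
pose f (u : W) : k^o := omega x u.1.1 - omega z u.2.2.
have f_lin : linear f.
  move=> a u v; rewrite /f /= !omega_linear_r opprD addrACA.
  by rewrite -mulrBr.
pose pd := HB.pack_for {linear W -> pc n} d (GRing.isLinear.Build k W (pc n) _ d d_lin).
pose pf := HB.pack_for {linear W -> k^o} f (GRing.isLinear.Build k W k^o _ f f_lin).
pose p1 (u : W) := u.1; pose p2 (u : W) := u.2.
have p1_lin : linear p1 by [].
have p2_lin : linear p2 by [].
pose q1 := HB.pack_for {linear W -> (pc m * pc n)%type} p1 (GRing.isLinear.Build k W _ _ p1 p1_lin).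
pose q2 := HB.pack_for {linear W -> (pc n * pc p)%type} p2 (GRing.isLinear.Build k W _ _ p2 p2_lin).
pose X := (linfun q1 @^-1: sval L :&: linfun q2 @^-1: sval M)%VS.
have XP u : (u \in X) = (u.1 \in sval L) && (u.2 \in sval M).
  by rewrite memv_cap -!memv_preim !lfunE.
have [|g gP] := @factor_functional W (pc n) X (linfun pd) pf.
  move=> [[x' y] [y' z']]; rewrite XP lfunE /= /d /f /= => /andP[xy yz] /eqP.
  rewrite subr_eq0 => /eqP eyy; move: yz; rewrite -eyy => yz.
  have /eqP := h (x', z') (introT (rel_compP _ _ _ _) (ex_intro2 _ _ y xy yz)).
  rewrite /rel_omega /= addrC subr_eq0 => /eqP ->; exact: subrr.
have [y yP] := omega_represents g.
have {}gP x' y1 y2 z' : related L x' y1 -> related M y2 z' ->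
    omega x x' - omega z z' = omega y y1 - omega y y2.
  move=> h1 h2.
  have hX : ((x', y1), (y2, z')) \in X by rewrite XP; apply/andP.
  by have := gP _ hX; rewrite lfunE /= /f /d /= yP => ->; rewrite omegaC omegaBl opprB [omega y2 y]omegaC
    [omega y1 y]omegaC opprK addrC.
have L0 : related L 0 0 by apply: mem0v.
have M0 : related M 0 0 by apply: mem0v.
apply/rel_compP; exists y.
  apply: lagrel_max => x' y' h'; have := gP _ _ _ _ h' M0.
  by rewrite !omega0r !subr0.
apply: lagrel_max => y' z' h'; have := gP _ _ _ _ L0 h'.
by rewrite !omega0r !sub0r => /oppr_inj.
Qed.

Definition lagrel_comp m n p (L : lagrel m n) (M : lagrel n p) : lagrel m p :=
  exist _ (rel_comp (sval L) (sval M)) (rel_comp_lagrangian L M).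

Lemma lagrel_compP m n p (L : lagrel m n) (M : lagrel n p) x z :
  reflect (exists2 y, related L x y & related M y z) (related (lagrel_comp L M) x z).
Proof. exact: rel_compP. Qed.

Definition pcl m n (x : pc (m + n)) : pc m := [ffun i => x (lshift n i)].
Definition pcr m n (x : pc (m + n)) : pc n := [ffun i => x (rshift m i)].
Definition pc_pair m n (x : pc m) (y : pc n) : pc (m + n) :=
  [ffun i => match split i with inl i => x i | inr i => y i end].

Lemma pcl_pair m n (x : pc m) (y : pc n) : pcl (pc_pair x y) = x.
Proof. by apply/ffunP => i; rewrite !ffunE splitL. Qed.

Lemma pcr_pair m n (x : pc m) (y : pc n) : pcr (pc_pair x y) = y.
Proof. by apply/ffunP => i; rewrite !ffunE splitR. Qed.

Lemma pc_pairK m n (x : pc (m + n)) : pc_pair (pcl x) (pcr x) = x.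
Proof. by apply/ffunP => i; rewrite !ffunE; case: split_ordP => j ->; rewrite ffunE. Qed.

Lemma omega_split m n (x y : pc (m + n)) :
  omega x y = omega (pcl x) (pcl y) + omega (pcr x) (pcr y).
Proof.
rewrite /omega big_split_ord; congr (_ + _); apply: eq_bigr => i _; by rewrite !ffunE.
Qed.

Section Tens.
Variables (m n p q : nat).
Let Z := (pc (m + p) * pc (n + q))%type.

Definition summand_l (z : Z) : (pc m * pc n)%type := (pcl z.1, pcl z.2).
Definition summand_r (z : Z) : (pc p * pc q)%type := (pcr z.1, pcr z.2).

Lemma summand_l_linear : linear summand_l.
Proof. by move=> a u v; congr pair; apply/ffunP => i; rewrite !ffunE. Qed.
Lemma summand_r_linear : linear summand_r.
Proof. by move=> a u v; congr pair; apply/ffunP => i; rewrite !ffunE. Qed.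
HB.instance Definition _ := GRing.isLinear.Build k Z _ _ summand_l summand_l_linear.
HB.instance Definition _ := GRing.isLinear.Build k Z _ _ summand_r summand_r_linear.

Definition rel_tens (L : {vspace pc m * pc n}) (M : {vspace pc p * pc q}) : {vspace Z} :=
  (linfun summand_l @^-1: L :&: linfun summand_r @^-1: M)%VS.

Lemma rel_tensE (L : {vspace pc m * pc n}) (M : {vspace pc p * pc q}) x y :
  ((x, y) \in rel_tens L M) = ((pcl x, pcl y) \in L) && ((pcr x, pcr y) \in M).
Proof. by rewrite memv_cap -!memv_preim !lfunE. Qed.

Lemma rel_tens_lagrangian (L : lagrel m n) (M : lagrel p q) :
  lagrangian (@rel_omega (m + p) (n + q)) (rel_tens (sval L) (sval M)).
Proof.
apply: mk_lagrangian.
  move=> [x y] [x' y']; rewrite !rel_tensE => /andP[h1 h2] /andP[h1' h2'].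
  rewrite /rel_omega /= !omega_split (lagrel_isotropic h1 h1') (lagrel_isotropic h2 h2').
  by rewrite addNr.
move=> [x y] h; rewrite rel_tensE.
have h0 x' y' : (x', y') \in rel_tens (sval L) (sval M) -> omega x x' = omega y y'.
  by move/h/eqP; rewrite /rel_omega addrC subr_eq0 => /eqP.
have e0 a : (0 : pc a, 0 : pc a) = 0 by [].
apply/andP; split; apply: lagrel_max => x' y' xy'.
  have := h0 (pc_pair x' 0) (pc_pair y' 0).
  rewrite rel_tensE !pcl_pair !pcr_pair mem0v !omega_split !pcl_pair !pcr_pair.
  by rewrite !omega0r !addr0 andbT; apply.
have := h0 (pc_pair 0 x') (pc_pair 0 y').
rewrite rel_tensE !pcl_pair !pcr_pair mem0v !omega_split !pcl_pair !pcr_pair.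
by rewrite !omega0r !add0r; apply.
Qed.

End Tens.

Definition lagrel_tens m n p q (L : lagrel m n) (M : lagrel p q) :
  lagrel (m + p) (n + q) :=
  exist _ (rel_tens (sval L) (sval M)) (rel_tens_lagrangian L M).

Lemma lagrel_tensE m n p q (L : lagrel m n) (M : lagrel p q) x y :
  related (lagrel_tens L M) x y = related L (pcl x) (pcl y) && related M (pcr x) (pcr y).
Proof. exact: rel_tensE. Qed.

Section Perm.
Variables (m n : nat) (h : 'I_n -> 'I_m).

Definition pc_pull (x : pc m) : pc n := [ffun i => x (h i)].

Definition perm_defect (z : (pc m * pc n)%type) : pc n := z.2 - pc_pull z.1.

Lemma perm_defect_linear : linear perm_defect.
Proof.
move=> a u v; apply/ffunP => i; rewrite !ffunE /=.
by rewrite scalerBr opprD addrACA.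
Qed.
HB.instance Definition _ :=
  GRing.isLinear.Build k (pc m * pc n)%type _ _ perm_defect perm_defect_linear.

Definition rel_perm : {vspace pc m * pc n} := lker (linfun perm_defect).

Lemma rel_permE x y : ((x, y) \in rel_perm) = (y == pc_pull x).
Proof. by rewrite memv_ker lfunE /= subr_eq0. Qed.

Lemma rel_perm_lagrangian : bijective h -> lagrangian (@rel_omega m n) rel_perm.
Proof.
move=> bh; have omegaE x y : omega (pc_pull x) (pc_pull y) = omega x y.
  rewrite /omega [RHS](reindex h); last exact: onW_bij.
  by apply: eq_bigr => i _; rewrite !ffunE.
apply: mk_lagrangian.
  move=> [x y] [x' y']; rewrite !rel_permE => /eqP -> /eqP ->.
  by rewrite /rel_omega /= omegaE addNr.
move=> [x y] e; rewrite rel_permE; apply/eqP; apply: omega_inj => z.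
case: bh => h' hK hK'; pose u : pc m := [ffun i => z (h' i)].
have -> : z = pc_pull u by apply/ffunP => i; rewrite !ffunE hK.
have := e (u, pc_pull u); rewrite rel_permE eqxx /rel_omega /= omegaE => /(_ isT)/eqP.
by rewrite addrC subr_eq0 => /eqP.
Qed.

End Perm.

Definition lagrel_id n : lagrel n n :=
  exist _ (rel_perm id) (rel_perm_lagrangian (inv_bij (fun=> erefl))).

Definition lagrel_sym m n : lagrel (m + n) (n + m) :=
  exist _ (rel_perm (@ord_swap n m))
    (rel_perm_lagrangian (Bijective (@ord_swapK n m) (@ord_swapK m n))).

Lemma pc_pull_id n (x : pc n) : pc_pull id x = x.
Proof. by apply/ffunP => i; rewrite ffunE. Qed.

Lemma lagrel_idE n x y : related (lagrel_id n) x y = (y == x).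
Proof. by rewrite /related rel_permE pc_pull_id. Qed.

Lemma lagrel_symE m n x y : related (lagrel_sym m n) x y = (y == pc_pair (pcr x) (pcl x)).
Proof.
rewrite /related rel_permE; congr (_ == _); apply/ffunP => i; rewrite !ffunE /ord_swap.
by case: (split i) => j; rewrite ffunE.
Qed.

Lemma lagrel_hcastE m m' n n' (em : m = m') (en : n = n') (L : lagrel m n) x y :
  related (hcast em en L) x y =
  related L (pc_pull (cast_ord em) x) (pc_pull (cast_ord en) y).
Proof.
case: m' / em x; case: n' / en y => y x /=.
by congr related; apply/ffunP => i; rewrite ffunE cast_ord_id.
Qed.

Lemma lagrel_ext m n (L M : lagrel m n) :
  (forall x y, related L x y <-> related M x y) -> L = M.
Proof. by move=> h; apply: lagrel_inj => x y; apply/idP/idP => /h. Qed.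

Lemma pc0_eq (x y : pc 0) : x = y.
Proof. by apply/ffunP => -[]. Qed.

Lemma pcl_castA m n p (x : pc (m + n + p)) :
  pcl (pc_pull (cast_ord (addnA m n p)) x) = pcl (pcl x).
Proof. by apply/ffunP => i; rewrite !ffunE cast_shift. Qed.

Lemma pcrl_castA m n p (x : pc (m + n + p)) :
  pcl (pcr (pc_pull (cast_ord (addnA m n p)) x)) = pcr (pcl x).
Proof. by apply/ffunP => i; rewrite !ffunE cast_shift. Qed.

Lemma pcrr_castA m n p (x : pc (m + n + p)) :
  pcr (pcr (pc_pull (cast_ord (addnA m n p)) x)) = pcr x.
Proof. by apply/ffunP => i; rewrite !ffunE cast_shift. Qed.

Definition is_graph m n (L : lagrel m n) (h : 'I_n -> 'I_m) : Prop :=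
  forall x y, related L x y = (y == pc_pull h x).

Lemma is_graph_id n : is_graph (lagrel_id n) id.
Proof. exact: rel_permE. Qed.

Lemma is_graph_sym m n : is_graph (lagrel_sym m n) (@ord_swap n m).
Proof. exact: rel_permE. Qed.

Lemma is_graph_comp m n p (L : lagrel m n) (M : lagrel n p) h h' :
  is_graph L h -> is_graph M h' -> is_graph (lagrel_comp L M) (h \o h').
Proof.
move=> Lh Mh' x y; have E : pc_pull (h \o h') x = pc_pull h' (pc_pull h x).
  by apply/ffunP => i; rewrite !ffunE.
apply/lagrel_compP/eqP => [[z]|->]; first by rewrite Lh Mh' E => /eqP -> /eqP.
by exists (pc_pull h x); rewrite ?Lh ?Mh' ?E.
Qed.

Lemma is_graph_tens m n p q (L : lagrel m n) (M : lagrel p q) h h' :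
  is_graph L h -> is_graph M h' -> is_graph (lagrel_tens L M) (ord_sum h h').
Proof.
move=> Lh Mh' x y; rewrite lagrel_tensE Lh Mh'.
have -> : pc_pull (ord_sum h h') x = pc_pair (pc_pull h (pcl x)) (pc_pull h' (pcr x)).
  apply/ffunP => i; rewrite !ffunE /ord_sum.
  by case: (split i) => j; rewrite !ffunE.
apply/andP/eqP => [[/eqP <- /eqP <-]|->]; first by rewrite pc_pairK.
by rewrite pcl_pair pcr_pair.
Qed.

Lemma is_graph_hcast m m' n n' (em : m = m') (en : n = n') (L : lagrel m n) h :
  is_graph L h ->
  is_graph (hcast em en L) (fun i => cast_ord em (h (cast_ord (esym en) i))).
Proof.
case: m' / em; case: n' / en => Lh x y; rewrite Lh; congr (_ == _).
by apply/ffunP => i; rewrite !ffunE !cast_ord_id.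
Qed.

Lemma is_graph_eq m n (L M : lagrel m n) h h' :
  is_graph L h -> is_graph M h' -> h =1 h' -> L = M.
Proof.
move=> Lh Mh' hh; apply: lagrel_inj => x y; rewrite Lh Mh'; congr (_ == _).
by apply/ffunP => i; rewrite !ffunE hh.
Qed.

Definition LagRel : prop.
Proof.
refine (@MkProp lagrel lagrel_id lagrel_comp lagrel_tens lagrel_sym
  _ _ _ _ _ _ _ _ _ _ _).
- move=> m n p q f g h; apply: lagrel_ext => x y; split.
    case/lagrel_compP => z xz /lagrel_compP[t zt ty]; apply/lagrel_compP.
    by exists t => //; apply/lagrel_compP; exists z.
  case/lagrel_compP => t /lagrel_compP[z xz zt] ty; apply/lagrel_compP.
  by exists z => //; apply/lagrel_compP; exists t.
- move=> m n f; apply: lagrel_ext => x y; split.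
    by case/lagrel_compP => z; rewrite lagrel_idE => /eqP ->.
  by move=> h; apply/lagrel_compP; exists x; rewrite ?lagrel_idE.
- move=> m n f; apply: lagrel_ext => x y; split.
    by case/lagrel_compP => z h; rewrite lagrel_idE => /eqP ->.
  by move=> h; apply/lagrel_compP; exists y; rewrite ?lagrel_idE.
- move=> m n; apply: lagrel_ext => x y; rewrite lagrel_tensE !lagrel_idE; split.
    by case/andP => /eqP e1 /eqP e2; rewrite -(pc_pairK y) e1 e2 pc_pairK.
  by move/eqP => ->; rewrite !eqxx.
- move=> m n p m' n' p' f g f' g'; apply: lagrel_ext => x y; rewrite lagrel_tensE; split.
    case/andP => /lagrel_compP[z xz zy] /lagrel_compP[z' xz' zy'].
    by apply/lagrel_compP; exists (pc_pair z z'); rewrite lagrel_tensE !pcl_pair !pcr_pair;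
      apply/andP.
  case/lagrel_compP => z; rewrite !lagrel_tensE => /andP[h1 h2] /andP[h1' h2'].
  apply/andP; split; apply/lagrel_compP; first by exists (pcl z).
  by exists (pcr z).
- move=> m n p m' n' p' f g h; apply: lagrel_inj => x y.
  by rewrite lagrel_hcastE !lagrel_tensE !pcl_castA !pcrl_castA !pcrr_castA andbA.
- move=> m n f; apply: lagrel_inj => x y.
  rewrite lagrel_hcastE lagrel_tensE lagrel_idE.
  rewrite [X in X && _](introT eqP (pc0_eq _ _)) /=.
  by congr related; apply/ffunP => i; rewrite !ffunE; congr (_ _); apply: val_inj.
- move=> m n f; apply: lagrel_inj => x y.
  rewrite lagrel_hcastE lagrel_tensE lagrel_idE.
  rewrite [X in _ && X](introT eqP (pc0_eq _ _)) andbT.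
  by congr related; apply/ffunP => i; rewrite !ffunE; congr (_ _); apply: val_inj.
- move=> m n m' n' f g; apply: lagrel_ext => x y; split.
    case/lagrel_compP => z; rewrite lagrel_tensE lagrel_symE => /andP[h1 h2] /eqP ->.
    apply/lagrel_compP; exists (pc_pair (pcr x) (pcl x)); rewrite ?lagrel_symE //.
    by rewrite lagrel_tensE !pcl_pair !pcr_pair h1 h2.
  case/lagrel_compP => z; rewrite lagrel_tensE lagrel_symE => /eqP ->.
  rewrite pcl_pair pcr_pair => /andP[h1 h2].
  apply/lagrel_compP; exists (pc_pair (pcr y) (pcl y)).
    by rewrite lagrel_tensE !pcl_pair !pcr_pair h1 h2.
  by rewrite lagrel_symE pcl_pair pcr_pair pc_pairK.
- move=> m n; apply: lagrel_ext => x y; rewrite lagrel_idE; split.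
    case/lagrel_compP => z; rewrite !lagrel_symE => /eqP -> /eqP ->.
    by rewrite pcl_pair pcr_pair pc_pairK.
  move/eqP => ->; apply/lagrel_compP; exists (pc_pair (pcr x) (pcl x)).
    by rewrite lagrel_symE.
  by rewrite lagrel_symE pcl_pair pcr_pair pc_pairK.
- move=> m n p; apply: is_graph_eq.
  + exact: is_graph_sym.
  + apply: is_graph_hcast; apply: is_graph_comp.
      by apply: is_graph_hcast; apply: is_graph_tens; [exact: is_graph_sym|exact: is_graph_id].
    by apply: is_graph_tens; [exact: is_graph_id|exact: is_graph_sym].
  + move=> i /=; rewrite cast_ord_id.
    case: (split_ordP i) => [j ->|c ->]; first case: (split_ordP j) => [a ->|b ->];
      by rewrite !(cast_shift, ord_sumL, ord_sumR, ord_swapL, ord_swapR).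
Defined.

End LinearRelations.

Definition corel_mu : hom FinCorel 2 1 := @one_block 2 1 isT.
Definition corel_delta : hom FinCorel 1 2 := @one_block 1 2 isT.
Definition corel_iota : hom FinCorel 0 1 := @one_block 0 1 isT.
Definition corel_epsilon : hom FinCorel 1 0 := @one_block 1 0 isT.

(* These corelations generate FinCorel, so this property characterizes K. *)
Definition K_on_generators (k : fieldType) (K : prop_mor FinCorel (LagRel k)) : Prop :=
  [/\ forall (x : pc k 2) (y : pc k 1),
        related (mor_map K corel_mu) x y <->
        [/\ (x ord0).1 = (x ord_max).1, (x ord_max).1 = (y ord0).1
          & (x ord0).2 + (x ord_max).2 = (y ord0).2],
      forall (x : pc k 1) (y : pc k 2),
        related (mor_map K corel_delta) x y <->
        [/\ (x ord0).1 = (y ord0).1, (y ord0).1 = (y ord_max).1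
          & (x ord0).2 = (y ord0).2 + (y ord_max).2],
      forall (x : pc k 0) (y : pc k 1),
        related (mor_map K corel_iota) x y <-> (y ord0).2 = 0
    & forall (x : pc k 1) (y : pc k 0),
        related (mor_map K corel_epsilon) x y <-> (x ord0).2 = 0].

(* Such a K exists: it relates (phi, I) to (phi', I') when phi and phi' are
   restrictions of a common potential on the blocks and the currents balance on
   each block.                                                                *)
Section KExists.
Variable k : fieldType.
Local Notation pc := (pc k).

Definition balanced m n (c : cospan m n) (x : pc m) (y : pc n) : Prop :=
  forall s, \sum_(i | lleg c i == s) (x i).2 = \sum_(j | rleg c j == s) (y j).2.

Section KCospan.
Variables (m n : nat) (c : cospan m n).
Let P := {ffun apex c -> k^o}.
Let Z := ((pc m * pc n) * P)%type.
Let D := (({ffun 'I_m -> k^o} * {ffun 'I_n -> k^o}) * P)%type.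

Definition K_defect (z : Z) : D :=
  ([ffun i => (z.1.1 i).1 - z.2 (lleg c i)], [ffun j => (z.1.2 j).1 - z.2 (rleg c j)],
   [ffun s => \sum_(i | lleg c i == s) (z.1.1 i).2 - \sum_(j | rleg c j == s) (z.1.2 j).2]).
Definition K_forget (z : Z) : (pc m * pc n)%type := z.1.

Lemma K_defect_linear : linear K_defect.
Proof.
have sE (a : k) (b : k^o) : a *: b = a * b by [].
move=> a u v; congr ((_, _), _); apply/ffunP => i; rewrite !ffunE /= ?ffunE /= ?sE.
- by rewrite opprD addrACA mulrBr.
- by rewrite opprD addrACA mulrBr.
- under eq_bigr do rewrite !ffunE /= sE.
  under [X in _ - X]eq_bigr do rewrite !ffunE /= sE.
  by rewrite !big_split /= -!mulr_sumr opprD addrACA mulrBr.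
Qed.
Lemma K_forget_linear : linear K_forget. Proof. by []. Qed.
HB.instance Definition _ := GRing.isLinear.Build k Z D _ K_defect K_defect_linear.
HB.instance Definition _ := GRing.isLinear.Build k Z _ _ K_forget K_forget_linear.

Definition K_space : {vspace pc m * pc n} := (linfun K_forget @: lker (linfun K_defect))%VS.

Lemma K_spaceP x y : (x, y) \in K_space <->
  (exists p : apex c -> k, (forall i, (x i).1 = p (lleg c i)) /\
                          (forall j, (y j).1 = p (rleg c j))) /\ balanced c x y.
Proof.
split.
  case/memv_imgP => [[[x' y'] p]]; rewrite memv_ker !lfunE /= => /eqP e [-> ->].
  have [e1 e2 e3] : [/\ (K_defect (x', y', p)).1.1 = 0, (K_defect (x', y', p)).1.2 = 0
    & (K_defect (x', y', p)).2 = 0] by rewrite e.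
  split.
    exists p; split=> i.
      by move/ffunP/(_ i): e1; rewrite !ffunE => /eqP; rewrite subr_eq0 => /eqP.
    by move/ffunP/(_ i): e2; rewrite !ffunE => /eqP; rewrite subr_eq0 => /eqP.
  by move=> s; move/ffunP/(_ s): e3; rewrite !ffunE => /eqP; rewrite subr_eq0 => /eqP.
move=> [[p [px py]] b]; apply/memv_imgP; exists ((x, y), [ffun s => p s]); last by rewrite lfunE.
rewrite memv_ker lfunE /=; apply/eqP; congr ((_, _), _); apply/ffunP => i; rewrite !ffunE /=.
- by rewrite px subrr.
- by rewrite py subrr.
- by rewrite b subrr.
Qed.

Let mp (A B C : Prop) : A -> (B -> C) -> (A -> B) -> C.
Proof. by move=> a bc ab; apply/bc/ab. Qed.

Let pot (x : pc m) (y : pc n) (a : 'I_m + 'I_n) : k :=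
  match a with inl i => (x i).1 | inr j => (y j).1 end.

Lemma K_lagrangian : lagrangian (@rel_omega k m n) K_space.
Proof.
apply: mk_lagrangian.
  move=> [x y] [x' y'] /K_spaceP[[p [px py]] b] /K_spaceP[[p' [px' py']] b'].
  rewrite /rel_omega /=; apply/eqP; rewrite addrC subr_eq0; apply/eqP.
  have E N (l : 'I_N -> apex c) (u u' : pc N) : (forall i, (u i).1 = p (l i)) ->
      (forall i, (u' i).1 = p' (l i)) ->
      omega u u' = \sum_s (p s * (\sum_(i | l i == s) (u' i).2) -
                           p' s * (\sum_(i | l i == s) (u i).2)).
    move=> pu pu'; rewrite /omega (partition_big l xpredT) //=; apply: eq_bigr => s _.
    rewrite !mulr_sumr -sumrB; apply: eq_bigr => i /eqP li.
    by rewrite /omega1 pu pu' li.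
  by rewrite (E _ _ _ _ px px') (E _ _ _ _ py py'); apply: eq_bigr => s _; rewrite b b'.
move=> [x y] h.
have {}h x' y' : (x', y') \in K_space -> omega x x' = omega y y'.
  by move/h/eqP; rewrite /rel_omega addrC subr_eq0 => /eqP.
have bal : balanced c x y.
  move=> s.
  have := h [ffun i => ((lleg c i == s)%:R, 0)] [ffun j => ((rleg c j == s)%:R, 0)].
  apply: mp.
    apply/K_spaceP; split.
      by exists (fun s' => (s' == s)%:R); split=> i; rewrite ffunE.
    by move=> s'; rewrite !big1 // => i _; rewrite ffunE.
  have E N (l : 'I_N -> apex c) (u : pc N) :
      omega u [ffun i => ((l i == s)%:R, 0)] = - \sum_(i | l i == s) (u i).2.
    rewrite -sumrN big_mkcond; apply: eq_bigr => i _; rewrite /omega1 ffunE /= mulr0 sub0r.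
    by case: eqP; rewrite ?mul1r // mul0r oppr0.
  by rewrite !E => /oppr_inj.
have pot_eq a b : leg c a = leg c b -> pot x y a = pot x y b.
  move=> ab.
  pose ex (a : 'I_m + 'I_n) : pc m := [ffun i => (0, (inl i == a)%:R)].
  pose ey (a : 'I_m + 'I_n) : pc n := [ffun j => (0, - (inr j == a)%:R)].
  have Eom : omega x (ex a - ex b) - omega y (ey a - ey b) = pot x y a - pot x y b.
    have E1 a' : omega x (ex a') = match a' with inl i => (x i).1 | _ => 0 end.
      rewrite /omega; case: a' => [i|j].
        rewrite (bigD1 i) //= big1 => [|i' ii]; rewrite /omega1 ffunE /=.
          by rewrite eqxx mulr1 mul0r subr0 addr0.
        rewrite -[inl i' == _]/(i' == i) (negPf ii) mulr0 mul0r subr0 //.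
      by rewrite big1 // => i _; rewrite /omega1 ffunE /= mulr0 mul0r subr0.
    have E2 a' : omega y (ey a') = match a' with inr i => - (y i).1 | _ => 0 end.
      rewrite /omega; case: a' => [i|j].
        by rewrite big1 // => j _; rewrite /omega1 ffunE /= oppr0 mulr0 mul0r subr0.
      rewrite (bigD1 j) //= big1 => [|j' jj]; rewrite /omega1 ffunE /=.
        by rewrite eqxx mulrN mulr1 mul0r subr0 addr0.
      by rewrite -[inr j' == _]/(j' == j) (negPf jj) oppr0 mulr0 mul0r subr0.
    have omegaBr N (u v w : pc N) : omega u (v - w) = omega u v - omega u w.
      by rewrite [LHS]omegaC omegaBl opprB [omega w u]omegaC [omega v u]omegaC opprK addrC.
    by rewrite !omegaBr !E1 !E2; case: a b {ab} => a [] b /=; ring.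
  have := h (ex a - ex b) (ey a - ey b).
  apply: mp.
    apply/K_spaceP; split.
      by exists (fun _ => 0); split=> i; rewrite !ffunE /= subr0.
    have S1 a' s : \sum_(i | lleg c i == s) (ex a' i).2 -
                   \sum_(j | rleg c j == s) (ey a' j).2 = (leg c a' == s)%:R.
      case: a' => [i|j].
        rewrite [X in _ - X]big1 => [|j _]; last by rewrite ffunE /= oppr0.
        rewrite subr0 big_mkcond (bigD1 i) //= big1 => [|i' ii].
          by rewrite ffunE /= eqxx addr0; case: eqP.
        by rewrite ffunE /= -[inl i' == _]/(i' == i) (negPf ii); case: ifP.
      rewrite [X in X - _]big1 => [|i _]; last by rewrite ffunE.
      rewrite sub0r big_mkcond (bigD1 j) //= big1 => [|j' jj].
        by rewrite ffunE /= eqxx addr0; case: eqP; rewrite ?opprK ?oppr0.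
      by rewrite ffunE /= -[inr j' == _]/(j' == j) (negPf jj) oppr0; case: ifP.
    move=> s; apply/eqP; rewrite -subr_eq0; apply/eqP.
    have SB N (Q : pred 'I_N) (u v : pc N) :
        \sum_(i | Q i) ((u - v) i).2 = \sum_(i | Q i) (u i).2 - \sum_(i | Q i) (v i).2.
      by rewrite -sumrB; apply: eq_bigr => i _; rewrite !ffunE.
    rewrite !SB.
    have /eqP := S1 a s; rewrite ab -(S1 b s) -subr_eq0 => /eqP e0; rewrite -[RHS]e0.
    rewrite !opprB addrACA [RHS]addrACA; congr (_ + _); exact: addrC.
  by move=> e; move: Eom; rewrite e subrr => /esym/eqP; rewrite subr_eq0 => /eqP.
apply/K_spaceP; split=> //.
exists (fun s => match pselect (exists a, leg c a = s) with
  | left e => pot x y (sval (cid e)) | right _ => 0 end).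
split=> i; case: pselect => [e|[]].
- by case: cid => a /= ea; rewrite (pot_eq _ (inl i) ea).
- by exists (inl i).
- by case: cid => a /= ea; rewrite (pot_eq _ (inr i) ea).
- by exists (inr i).
Qed.

Definition K_cospan : lagrel k m n := exist _ K_space K_lagrangian.

End KCospan.

Lemma lagrel_sub m n (L M : lagrel k m n) :
  (forall x y, related L x y -> related M x y) -> L = M.
Proof.
move=> h; apply/esym; case: L M h => [L hL] [M hM] /= h; apply: eq_exist.
by apply: hL.2; [exact: hM.1|apply/subvP => -[x y]; apply: h].
Qed.

Lemma K_cospan_mono m n (c d : cospan m n) (h : apex c -> apex d) : injective h ->
  (forall i, h (lleg c i) = lleg d i) -> (forall j, h (rleg c j) = rleg d j) ->
  K_cospan d = K_cospan c.
Proof.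
move=> hi hl hr; apply: lagrel_sub => x y /K_spaceP[[p [px py]] b].
apply/K_spaceP; split; first by exists (p \o h); split=> i /=; rewrite ?hl ?hr.
move=> s; have := b (h s).
under eq_bigl do rewrite -hl (inj_eq hi).
by under [X in _ = X]eq_bigl do rewrite -hr (inj_eq hi).
Qed.

Lemma K_cospan_repr m n (c : cospan m n) : K_cospan (qrepr (cls (@cospan_iso m n) c)) = K_cospan c.
Proof. by have [h [hb hl hr]] := repr_cospan c; apply: K_cospan_mono hl hr; apply: bij_inj. Qed.

Lemma K_cospan_restrict m n (c : cospan m n) : K_cospan (cospan_restrict c) = K_cospan c.
Proof.
by apply/esym/(@K_cospan_mono _ _ (cospan_restrict c) c val) => //; apply: val_inj.
Qed.

Lemma K_cospan_comp m n p (c : cospan m n) (d : cospan n p) :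
  K_cospan (cospan_comp c d) = lagrel_comp (K_cospan c) (K_cospan d).
Proof.
apply/esym/lagrel_sub => x z /lagrel_compP[y].
move=> /K_spaceP[[q [qx qy]] b] /K_spaceP[[r [ry rz]] b'].
have [ab j u] := pushoutP (rleg c) (lleg d).
have [|w [wl wr]] := u _ q r; first by move=> i; rewrite -qy -ry.
apply/K_spaceP; split; first by exists w; split=> i; rewrite /= ?wl ?wr.
move=> s /=.
rewrite (partition_big (lleg c) (fun t => po_inl (rleg c) (lleg d) t == s)) //=.
rewrite [RHS](partition_big (rleg d) (fun t => po_inr (rleg c) (lleg d) t == s)) //=.
have E N (l : 'I_N -> apex c) (v : pc N) t : po_inl (rleg c) (lleg d) t == s ->
    \sum_(i | (po_inl (rleg c) (lleg d) (l i) == s) && (l i == t)) (v i).2 =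
    \sum_(i | l i == t) (v i).2.
  by move=> ts; apply: eq_bigl => i; rewrite andbC; case: eqP => // ->.
have E' N (l : 'I_N -> apex d) (v : pc N) t : po_inr (rleg c) (lleg d) t == s ->
    \sum_(i | (po_inr (rleg c) (lleg d) (l i) == s) && (l i == t)) (v i).2 =
    \sum_(i | l i == t) (v i).2.
  by move=> ts; apply: eq_bigl => i; rewrite andbC; case: eqP => // ->.
rewrite (eq_bigr _ (fun t ts => etrans (E _ _ _ t ts) (etrans (b t) (esym (E _ _ _ t ts))))).
rewrite [RHS](eq_bigr _ (fun t ts => etrans (E' _ _ _ t ts) (etrans (esym (b' t)) (esym (E' _ _ _ t ts))))).
rewrite -(partition_big (rleg c) (fun t => po_inl (rleg c) (lleg d) t == s)) //=.
rewrite -(partition_big (lleg d) (fun t => po_inr (rleg c) (lleg d) t == s)) //=.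
by apply: eq_bigl => i; rewrite ab.
Qed.

Lemma K_cospan_tens m n p q (c : cospan m n) (d : cospan p q) :
  K_cospan (cospan_tens c d) = lagrel_tens (K_cospan c) (K_cospan d).
Proof.
apply/esym/lagrel_sub => x y; rewrite lagrel_tensE.
move=> /andP[/K_spaceP[[r [rx ry]] b] /K_spaceP[[r' [rx' ry']] b']].
apply/K_spaceP; split.
  exists (fun s => match s with inl s => r s | inr s => r' s end); split=> i /=;
    by case: (split_ordP i) => j -> /=; rewrite -?rx -?rx' -?ry -?ry' ffunE.
have E N M (T T' : finType) (l : 'I_N -> T) (l' : 'I_M -> T') (v : pc (N + M)) s :
    \sum_(i | sum_map l l' (split i) == s) (v i).2 =
    match s with inl s => \sum_(i | l i == s) (pcl v i).2
               | inr s => \sum_(i | l' i == s) (pcr v i).2 end.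
  rewrite big_split_ord /=; case: s => s.
    rewrite [X in _ + X]big1 ?addr0 => [|i]; last by rewrite splitR.
    by apply: eq_big => i; rewrite ?splitL ?ffunE.
  rewrite [X in X + _]big1 ?add0r => [|i]; last by rewrite splitL.
  by apply: eq_big => i; rewrite ?splitR ?ffunE.
by move=> s /=; rewrite !E; case: s => s.
Qed.

Lemma K_cospan_graph m n (h : 'I_n -> 'I_m) (L : lagrel k m n) :
  bijective h -> is_graph L h -> K_cospan (@Cospan m n 'I_m id h) = L.
Proof.
move=> hi Lh; apply/esym/lagrel_sub => x y; rewrite Lh => /eqP ->; apply/K_spaceP; split.
  by exists (fun i => (x i).1); split=> // j; rewrite ffunE.
move=> s /=; rewrite (reindex h) /=; last exact: onW_bij.
by apply: eq_bigr => j _; rewrite ffunE.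
Qed.

Lemma K_cospan_H m n (c : cospan m n) :
  K_cospan (qrepr (sval (corel_of_cospan (cls _ c)))) = K_cospan c.
Proof. by rewrite /= K_cospan_repr K_cospan_restrict K_cospan_repr. Qed.

Definition K_mor : prop_mor FinCorel (LagRel k).
Proof.
exists (fun m n (x : corel m n) => K_cospan (qrepr (sval x))).
- move=> n; rewrite /= K_cospan_repr.
  exact: (@K_cospan_graph n n id (lagrel_id k n) (inv_bij (fun=> erefl)) (is_graph_id (n:=n))).
- by move=> m n p f g; rewrite [LHS]K_cospan_H K_cospan_comp.
- by move=> m n p q f g; rewrite /= K_cospan_repr K_cospan_tens.
- move=> m n; rewrite /= K_cospan_repr.
  exact: (@K_cospan_graph _ _ (@ord_swap n m) (lagrel_sym k m n)
    (Bijective (@ord_swapK n m) (@ord_swapK m n)) (is_graph_sym (m:=m) (n:=n))).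
Defined.

Lemma K_mor_on_generators : K_on_generators K_mor.
Proof.
have KE m n (mn : (0 < m + n)%N) x y : related (mor_map K_mor (one_block mn)) x y <->
    (exists p : k, (forall i, (x i).1 = p) /\ (forall j, (y j).1 = p)) /\
    \sum_i (x i).2 = \sum_j (y j).2.
  have -> : mor_map K_mor (one_block mn) = K_cospan (one_block_cospan m n).
    exact: K_cospan_repr.
  split.
    by move=> /K_spaceP[[p [px py]] /(_ tt) b]; split=> //; exists (p tt).
  by move=> [[p [px py]] b]; apply/K_spaceP; split=> [|[]] //; exists (fun _ => p).
have o2 (i : 'I_2) : i = ord0 \/ i = ord_max.
  by case: i => -[|[|//]] lt; [left|right]; apply: val_inj.
have S2 (F : 'I_2 -> k) : \sum_i F i = F ord0 + F ord_max.
  by rewrite big_ord_recr big_ord1; congr (F _ + _); apply: val_inj.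
split=> x y; rewrite /corel_mu /corel_delta /corel_iota /corel_epsilon KE ?S2 ?big_ord1 ?big_ord0.
- split=> [[[p [px py]] ->]|[e1 e2 ->]]; first by rewrite !px !py.
  split=> //; exists (y ord0).1; split=> i; last by rewrite ord1.
  by case: (o2 i) => ->; rewrite ?e1 ?e2.
- split=> [[[p [px py]] ->]|[e1 e2 ->]]; first by rewrite !px !py.
  split=> //; exists (x ord0).1; split=> i; first by rewrite ord1.
  by case: (o2 i) => ->; rewrite ?e1 ?e2.
- split=> [[_ <-] //|->]; split=> //; exists (y ord0).1.
  by split=> [[]|i] //; rewrite ord1.
- split=> [[_ ->] //|->]; split=> //; exists (x ord0).1.
  by split=> [i|[]] //; rewrite ord1.
Qed.

Lemma K_exists : exists K : prop_mor FinCorel (LagRel k), K_on_generators K.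
Proof. by exists K_mor; apply: K_mor_on_generators. Qed.

End KExists.

(* Main.v *)
Require Import Defs.
From HB Require Import structures.
From mathcomp Require Import all_boot all_order all_algebra.
From mathcomp Require Import boolp ring.

Set Implicit Arguments.
Unset Strict Implicit.
Unset Printing Implicit Defensive.

Import GRing.Theory.

(** A circuit whose edge e carries the label Z_e has a physical behaviour: the
    boundary potentials and currents that extend to a potential p on the nodes
    and a current I_e along each edge, subject to Ohm's law
    p (tgt e) - p (src e) = Z_e I_e and to Kirchhoff's current law at each node.
    The black box functor sends a circuit to this relation.

    Kirchhoff's law is used in its weak form, tested against an arbitrary
    function q on the nodes ([operates]). Taking q to be the potential of a
    second state of the same circuit gives Tellegen's theorem ([tellegen]): any
    two states have equal symplectic pairings at the inputs and at the outputs,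
    so the behaviour is isotropic.

    For the behaviour to be a Lagrangian subspace, the normal form of a circuit
    is used ([circuit_factor]): with N nodes and E edges,
      c = A ; (e_1 + ... + e_E + id_N) ; B,
    where A and B are cospans, both with the nodes of c as apex, and e_i are
    single edges. [black_box c] is the composite of the
    corresponding Lagrangian relations. Its elements come from states of c, and
    conversely every state of c gives an element, because a Lagrangian relation
    contains every vector that it is orthogonal to ([black_boxP]).

    An inclusion between Lagrangian subspaces is an equality, so
    functoriality needs only one inclusion each time: states of two circuits
    glue to a state of the composite, or of the tensor product.

    Uniqueness is again the normal form: a morphism of props out of circuits is
    determined by its values on cospans and on edges ([circ_mor_ext]).

    Finally K is only known on four corelations. Every function between finite
    ordinals is built from merging two points, adding one point and swapping two
    points ([ord_fun_ind]), and every cospan is a function followed by a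
    reversed function ([cospan_factor]). Hence a morphism out of cospans is
    determined by four values ([fincospan_mor_ext]), and K H is the morphism
    [K_mor] H, whose values are explicit. *)

Local Notation hom := Defs.hom.

(** * Generators of functions and of cospans *)
Lemma eq_prop_mor (A B : prop) (F G : prop_mor A B) :
  (forall m n (f : hom A m n), mor_map F f = mor_map G f) -> F = G.
Proof.
case: F G => [F Fi Fc Ft Fs] [G Gi Gc Gt Gs] /= FG.
have {}FG : F = G by apply/functional_extensionality_dep => m;
  apply/functional_extensionality_dep => n; apply/funext => f; apply: FG.
move: Fi Fc Ft Fs Gi Gc Gt Gs; rewrite FG => *; congr PropMor; exact: Prop_irrelevance.
Qed.

Section FinSetGeneration.
Variable P : forall m n, ('I_m -> 'I_n) -> Prop.
Hypothesis P_id : forall n, P (@id 'I_n).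
Hypothesis P_comp : forall m n p (h : 'I_m -> 'I_n) (g : 'I_n -> 'I_p),
  P h -> P g -> P (g \o h).
Hypothesis P_sum : forall m n p q (h : 'I_m -> 'I_n) (g : 'I_p -> 'I_q),
  P h -> P g -> P (ord_sum h g).
Hypothesis P_swap : P (@ord_swap 1 1).
Hypothesis P_merge : P (fun _ : 'I_2 => ord0 : 'I_1).
Hypothesis P_init : P (fun _ : 'I_0 => ord0 : 'I_1).

Lemma P_from0 n (h : 'I_0 -> 'I_n) : P h.
Proof.
elim: n h => [|n IH] h.
  by rewrite (_ : h = id) //; apply/funext => -[].
rewrite (_ : h = ord_sum (fun _ : 'I_0 => ord0 : 'I_1) (widen_ord (leq0n n))).
  exact: (@P_sum 0 1 0 n).
by apply/funext => -[].
Qed.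

(** Identify the new first point with the point b. These maps take the place of
    general permutations: they let a function be built one value at a time. *)
Definition fold_at n (b : 'I_n) (i : 'I_(1 + n)) : 'I_n :=
  match split i with inl _ => b | inr j => j end.

Lemma ord_12n_ind n (Q : 'I_(1 + (1 + n)) -> Prop) :
  Q (@lshift 2 n (@lshift 1 1 ord0)) -> Q (@lshift 2 n (@rshift 1 1 ord0)) ->
  (forall j : 'I_n, Q (rshift 2 j)) -> forall i, Q i.
Proof.
move=> Q0 Q1 Q2 i; case: (@split_ordP 2 n i) => j -> //.
by case: (@split_ordP 1 1 j) => a ->; rewrite ord1.
Qed.

(** The points of 1 + (1 + n), read as points of 2 + n: the two sums are
    convertible, but [lshift] and [rshift] do not see it. *)
Lemma ord_12n_shift n :
  [/\ @lshift 2 n (@lshift 1 1 ord0) = lshift (1 + n) (ord0 : 'I_1),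
      @lshift 2 n (@rshift 1 1 ord0) = rshift 1 (lshift n (ord0 : 'I_1)) :> 'I_(1 + (1 + n))
    & forall j : 'I_n, rshift 2 j = rshift 1 (rshift 1 j) :> 'I_(1 + (1 + n))].
Proof. by split=> *; apply: val_inj. Qed.

(** Induction on the position of b: at the first point it is a merging, and
    otherwise the new point is swapped past the first one. *)
Lemma P_fold_at n (b : 'I_n) : P (fold_at b).
Proof.
elim: n b => [[]//|n IH] b; have [s0 s1 s2] := ord_12n_shift n.
case: (@split_ordP 1 n b) => {b} b ->.
  rewrite (_ : fold_at _ = ord_sum (fun _ : 'I_2 => ord0 : 'I_1) (@id 'I_n)).
    exact: (@P_sum 2 1 n n).
  apply/funext; apply: ord_12n_ind => [||j];
    rewrite ?ord_sumL ?ord_sumR ?s0 ?s1 ?s2 /fold_at ?splitL ?splitR //.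
  by rewrite ord1.
rewrite (_ : fold_at _ =
  ord_sum (@id 'I_1) (fold_at b) \o ord_sum (@ord_swap 1 1) (@id 'I_n)).
  apply: (@P_comp (1 + (1 + n)) (1 + (1 + n)) (1 + n)); last exact: P_sum.
  exact: (@P_sum 2 2 n n).
by apply/funext; apply: ord_12n_ind => [||j] /=;
  rewrite ?ord_sumL ?ord_sumR ?ord_swapL ?ord_swapR ?s0 ?s1 ?s2 ?ord_sumL ?ord_sumR
    /fold_at ?splitL ?splitR.
Qed.

(** A function on 1 + m points is its restriction to the last m points, next to
    a new target point which is then folded onto the value at the first point. *)
Lemma ord_fun_ind m n (h : 'I_m -> 'I_n) : P h.
Proof.
elim: m h => [|m IH] h; first exact: P_from0.
rewrite (_ : h = fold_at (h ord0) \o ord_sum (@id 'I_1) (h \o @rshift 1 m)).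
  by apply: (@P_comp (1 + m) (1 + n) n); [apply: P_sum|apply: P_fold_at].
apply/funext => i /=; case: (@split_ordP 1 m i) => j ->.
  by rewrite ord_sumL ord1 /fold_at splitL; congr h; apply: val_inj.
by rewrite ord_sumR /fold_at splitR.
Qed.

End FinSetGeneration.

Definition rgraph m n (h : 'I_m -> 'I_n) : hom FinCospan n m :=
  cls _ (@Cospan n m 'I_n id h).
Definition lgraph m n (h : 'I_m -> 'I_n) : hom FinCospan m n :=
  cls _ (@Cospan m n 'I_n h id).

Lemma rgraph_comp m n p (h : 'I_m -> 'I_n) (g : 'I_n -> 'I_p) :
  rgraph (g \o h) = prop_comp (rgraph g) (rgraph h).
Proof.
apply: (@circ_of_cospan_inj void); rewrite circ_of_cospan_comp !circ_of_cospanE.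
by rewrite -[LHS]circ_graph_comp_graph.
Qed.

Lemma rgraph_sum m n p q (h : 'I_m -> 'I_n) (g : 'I_p -> 'I_q) :
  rgraph (ord_sum h g) = prop_tens (rgraph h) (rgraph g).
Proof.
apply: (@circ_of_cospan_inj void); rewrite circ_of_cospan_tens !circ_of_cospanE.
by rewrite -[LHS]circ_tens_graph.
Qed.

(** In each use the pushout is one of the two apexes, which compares more easily
    with other cospans than the quotient that defines composition. *)
Lemma fincospan_comp_po m n p (c : cospan m n) (d : cospan n p) (U : finType)
    (a : apex c -> U) (b : apex d -> U) :
  is_po (rleg c) (lleg d) a b ->
  prop_comp (cls _ c : hom FinCospan m n) (cls _ d : hom FinCospan n p) =
  cls _ (@Cospan m p U (fun i => a (lleg c i)) (fun j => b (rleg d j))).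
Proof.
move=> po; apply: (@circ_of_cospan_inj void); rewrite circ_of_cospan_comp !circ_of_cospanE.
rewrite (@circ_comp_po _ _ _ _ (circuit_of_cospan void c) (circuit_of_cospan void d) _ _ _ po).
apply: eq_ccls; exists id, (fun v => match v with inl v => v | inr v => v end).
by split; split=> //; [exists id|exists inl => -[]|case|case|case].
Qed.

Lemma fincospan_tensE m n p q (c : cospan m n) (d : cospan p q) :
  prop_tens (cls _ c : hom FinCospan m n) (cls _ d : hom FinCospan p q) =
  cls _ (cospan_tens c d).
Proof.
apply: (@circ_of_cospan_inj void); rewrite circ_of_cospan_tens !circ_of_cospanE circ_tensE.
apply: eq_ccls; exists id, (fun v => match v with inl v => v | inr v => v end).
by split; split=> //; [exists id|exists inl => -[]|case|case|case].
Qed.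

Lemma lgraph_comp m n p (h : 'I_m -> 'I_n) (g : 'I_n -> 'I_p) :
  lgraph (g \o h) = prop_comp (lgraph h) (lgraph g).
Proof.
rewrite (@fincospan_comp_po _ _ _ (@Cospan m n 'I_n h id) (@Cospan n p 'I_p g id) 'I_p g id) //.
split=> //= [u|X q r qr]; first by right; exists u.
by exists r; split.
Qed.

Lemma lgraph_sum m n p q (h : 'I_m -> 'I_n) (g : 'I_p -> 'I_q) :
  lgraph (ord_sum h g) = prop_tens (lgraph h) (lgraph g).
Proof.
rewrite fincospan_tensE; apply: eq_cospan_cls; exists split; split=> //=.
- by exists unsplit; [exact: splitK|exact: unsplitK].
- by move=> i; rewrite /ord_sum unsplitK.
- by move=> i; case: (split i).
Qed.

(** The functions must be between ordinals, so the apex is first replaced by an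
    enumeration of it. *)
Lemma cospan_factor m n (c : cospan m n) :
  cls _ c = prop_comp (lgraph (enum_rank \o lleg c)) (rgraph (enum_rank \o rleg c)).
Proof.
rewrite (@fincospan_comp_po _ _ _ (@Cospan m #|apex c| _ (enum_rank \o lleg c) id)
  (@Cospan #|apex c| n _ id (enum_rank \o rleg c)) _ id id).
  by apply: eq_cospan_cls; exists enum_rank; split=> //; exists enum_val;
    [exact: enum_rankK|exact: enum_valK].
split=> //= [u|X q r qr]; first by left; exists u.
by exists q; split=> // i; rewrite -qr.
Qed.

Definition block m n : hom FinCospan m n := cls _ (one_block_cospan m n).

Lemma lgraph_const m : lgraph (fun _ : 'I_m => ord0 : 'I_1) = block m 1.
Proof.
apply: eq_cospan_cls; exists (fun _ => tt); split=> //.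
by exists (fun _ => ord0) => [i|[]] //; rewrite [RHS]ord1.
Qed.

Lemma rgraph_const m : rgraph (fun _ : 'I_m => ord0 : 'I_1) = block 1 m.
Proof.
apply: eq_cospan_cls; exists (fun _ => tt); split=> //.
by exists (fun _ => ord0) => [i|[]] //; rewrite [RHS]ord1.
Qed.

(** The functions h for which two morphisms agree on [rgraph h] are closed under
    composition and sum, and so are those for [lgraph h]; [ord_fun_ind] applies
    to both classes. *)
Lemma fincospan_mor_ext (B : prop) (F G : prop_mor FinCospan B) :
  mor_map F (block 2 1) = mor_map G (block 2 1) ->
  mor_map F (block 1 2) = mor_map G (block 1 2) ->
  mor_map F (block 0 1) = mor_map G (block 0 1) ->
  mor_map F (block 1 0) = mor_map G (block 1 0) -> F = G.
Proof.
move=> mu delta iota eps; apply: eq_prop_mor => m n x.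
have FGr a b (h : 'I_a -> 'I_b) : mor_map F (rgraph h) = mor_map G (rgraph h).
  apply: (@ord_fun_ind (fun a b h => mor_map F (@rgraph a b h) = mor_map G (rgraph h)));
    rewrite ?rgraph_const //.
  - by move=> N; rewrite -/(prop_id FinCospan N) !mor_map_id.
  - by move=> *; rewrite rgraph_comp !mor_map_comp; congr prop_comp.
  - by move=> *; rewrite rgraph_sum !mor_map_tens; congr prop_tens.
  - by rewrite -/(prop_sym FinCospan 1 1) !mor_map_sym.
have FGl a b (h : 'I_a -> 'I_b) : mor_map F (lgraph h) = mor_map G (lgraph h).
  apply: (@ord_fun_ind (fun a b h => mor_map F (@lgraph a b h) = mor_map G (lgraph h)));
    rewrite ?lgraph_const //.
  - by move=> N; rewrite -/(prop_id FinCospan N) !mor_map_id.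
  - by move=> *; rewrite lgraph_comp !mor_map_comp; congr prop_comp.
  - by move=> *; rewrite lgraph_sum !mor_map_tens; congr prop_tens.
  - have -> : lgraph (@ord_swap 1 1) = prop_sym FinCospan 1 1.
      apply: eq_cospan_cls; exists (@ord_swap 1 1); split=> //= [|i].
        by exists (@ord_swap 1 1); apply: ord_swapK.
      by rewrite ord_swapK.
    by rewrite !mor_map_sym.
by rewrite -[x]qreprK cospan_factor !mor_map_comp FGl FGr.
Qed.

(** * Normal form of circuits *)

Fixpoint tens_all (A : prop) e : ('I_e -> hom A 1 1) -> hom A e e :=
  match e with
  | 0 => fun _ => prop_id A 0
  | e.+1 => fun f => @prop_tens A 1 1 e e (f ord0) (tens_all (fun i => f (@rshift 1 e i)))
  end.

Lemma mor_map_tens_all (A B : prop) (F : prop_mor A B) e (f : 'I_e -> hom A 1 1) :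
  mor_map F (tens_all f) = tens_all (fun i => mor_map F (f i)).
Proof.
elim: e f => [|e IH] f /=; first exact: mor_map_id.
by rewrite (@mor_map_tens _ _ F 1 1 e e) IH.
Qed.

Section NormalForm.
Variable L : Type.

Lemma tens_all_edges e (f : 'I_e -> L) :
  tens_all (fun i => circ_edge (f i)) =
  cls _ (@Circuit L e e (@Cospan e e ('I_e + 'I_e)%type inl inr) 'I_e inl inr f).
Proof.
elim: e f => [|e IH] f /=.
  apply: eq_ccls; exists inl, (of_void _); split; split=> //=; try by case.
  - by exists (fun x => match x with inl x => x | inr x => x end) => // -[[]|[]].
  - by exists (fun x : 'I_0 => False_rect void (notF (ltn_ord x))) => -[].
rewrite IH [LHS]circ_tensE; apply: eq_ccls.
exists (fun x : bool + ('I_e + 'I_e) => match x with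
  | inl false => inl (@lshift 1 e ord0) | inl true => inr (@lshift 1 e ord0)
  | inr (inl i) => inl (@rshift 1 e i) | inr (inr i) => inr (@rshift 1 e i) end).
exists (fun x : unit + 'I_e => match x with
  | inl _ => @lshift 1 e ord0 | inr i => @rshift 1 e i end).
split; split=> //=.
- exists (fun x : 'I_(1 + e) + 'I_(1 + e) => match x with
  | inl i => match split i with inl _ => inl false | inr j => inr (inl j) end
  | inr i => match split i with inl _ => inl true | inr j => inr (inr j) end end).
    by move=> [[]|[i|i]] /=; rewrite ?splitL ?splitR.
  by move=> [i|i]; case: (split_ordP i) => j ->; rewrite ?(ord1 j).
- by move=> i; case: (@split_ordP 1 e i) => j -> /=; rewrite ?(ord1 j).
- by move=> i; case: (@split_ordP 1 e i) => j -> /=; rewrite ?(ord1 j).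
- exists (fun i : 'I_(1 + e) =>
    match split i with inl _ => inl tt | inr j => inr j end).
    by move=> [[]|i] /=; rewrite ?splitL ?splitR.
  by move=> i; case: (split_ordP i) => j ->; rewrite ?(ord1 j).
- by case.
- by case.
- by case=> [[]|i] //=; congr f; apply: val_inj.
Qed.

Variables (m n : nat) (c : circuit L m n).
Local Notation E := #|edges c|.
Local Notation N := #|apex c|.

(** One wire for each edge, attached at the end v of the edge, and one wire for
    each node. *)
Definition end_and_nodes (v : edges c -> apex c) (i : 'I_(E + N)) : apex c :=
  match split i with inl a => v (enum_val a) | inr b => enum_val b end.

Definition source_cospan : cospan m (E + N) :=
  @Cospan m (E + N) (apex c) (lleg c) (end_and_nodes (@src _ _ _ c)).
Definition target_cospan : cospan (E + N) n :=
  @Cospan (E + N) n (apex c) (end_and_nodes (@tgt _ _ _ c)) (rleg c).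

Definition edge_lab (i : 'I_E) : L := lab (enum_val i).

(** The source of each edge is reached through the first E wires of
    [source_cospan], its target through those of [target_cospan]; the last N
    wires identify the two copies of the set of nodes. *)
Lemma circuit_factor : (cls _ c : hom (Circ L) m n) =
  prop_comp (mor_map (cospan_to_circ L) (cls _ source_cospan))
   (prop_comp (prop_tens (tens_all (fun i => circ_edge (edge_lab i))) (prop_id (Circ L) N))
     (mor_map (cospan_to_circ L) (cls _ target_cospan))).
Proof.
rewrite tens_all_edges /= !circ_of_cospanE circ_tensE.
set w := circuit_tens _ _.
(* Gluing the edges to the targets leaves the sources free. *)
rewrite (@circ_comp_po _ _ _ _ w (circuit_of_cospan L target_cospan) ('I_E + apex c)%type
  (fun x : ('I_E + 'I_E) + 'I_N => match x with
     | inl (inl i) => inl i | inl (inr i) => inr (tgt (enum_val i))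
     | inr b => inr (enum_val b) end) inr); last first.
  split=> /=.
  - by move=> x; rewrite /end_and_nodes; case: (split x).
  - by move=> [i|s]; [left; exists (inl (inl i))|right; exists s].
  - move=> X p q pq.
    exists (fun x => match x with inl i => p (inl (inl i)) | inr s => q s end); split=> //.
    move=> [[i|i]|b] //=.
      by have := pq (lshift _ i); rewrite /end_and_nodes splitL.
    by have := pq (rshift _ b); rewrite /end_and_nodes splitR.
set d := Circuit _ _ _.
rewrite (@circ_comp_po _ _ _ _ (circuit_of_cospan L source_cospan) d (apex c)
  id (fun x : 'I_E + apex c => match x with inl i => src (enum_val i) | inr s => s end)).
  apply: eq_ccls; exists id.
  exists (fun x : edges c => inr (inl (inl (enum_rank x)))); split; split=> //=.
  - by exists id.
  - by exists (fun x : void + (('I_E + void) + void) => match x with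
      | inr (inl (inl i)) => enum_val i | inr (inl (inr v)) => of_void _ v
      | inr (inr v) => of_void _ v | inl v => of_void _ v end) =>
      [x|[[]|[[i|[]]|[]]]]; rewrite ?enum_rankK ?enum_valK.
  - by move=> x; rewrite enum_rankK.
  - by move=> x; rewrite enum_rankK.
  - by move=> x; rewrite /edge_lab enum_rankK.
split=> /=.
- by move=> x; rewrite /end_and_nodes; case: (split x).
- by move=> s; left; exists s.
- move=> X p q pq; exists p; split=> // -[i|s].
    by have := pq (lshift _ i); rewrite /end_and_nodes splitL.
  by have := pq (rshift _ (enum_rank s)); rewrite /end_and_nodes splitR /= enum_rankK.
Qed.

End NormalForm.

Lemma circ_mor_ext (L : Type) (B : prop) (F G : prop_mor (Circ L) B) :
  prop_mor_comp F (cospan_to_circ L) = prop_mor_comp G (cospan_to_circ L) ->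
  (forall l, mor_map F (circ_edge l) = mor_map G (circ_edge l)) -> F = G.
Proof.
move=> FGc FGe; apply: eq_prop_mor => m n x; rewrite -[x]qreprK circuit_factor.
have {}FGc a b (y : hom FinCospan a b) :
    mor_map F (mor_map (cospan_to_circ L) y) = mor_map G (mor_map (cospan_to_circ L) y).
  by rewrite -[LHS]/(mor_map (prop_mor_comp F _) y) FGc.
rewrite !(mor_map_comp, mor_map_tens) !FGc !mor_map_tens_all !mor_map_id.
by under [in LHS]eq_fun do rewrite FGe.
Qed.

Local Open Scope ring_scope.

(** * Resistors *)

Section BlackBox.
Variable k : fieldType.

Section Resistor.
Variable Z : k.

Definition ohm_defect (u : (pc k 1 * pc k 1)%type) : (k^o * k^o)%type :=
  ((u.2 ord0).1 - (u.1 ord0).1 - Z * (u.1 ord0).2, (u.1 ord0).2 - (u.2 ord0).2).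

Lemma ohm_defect_linear : linear ohm_defect.
Proof.
have sE (a : k) (b : k^o) : a *: b = a * b by [].
by move=> a u v; congr pair; rewrite !ffunE /= !sE; ring.
Qed.
HB.instance Definition _ :=
  GRing.isLinear.Build k (pc k 1 * pc k 1)%type _ _ ohm_defect ohm_defect_linear.

Definition ohm_space : {vspace pc k 1 * pc k 1} := lker (linfun ohm_defect).

Lemma ohm_spaceP x y : (x, y) \in ohm_space <->
  (y ord0).1 - (x ord0).1 = Z * (x ord0).2 /\ (x ord0).2 = (y ord0).2.
Proof.
rewrite memv_ker lfunE /=; split.
  by case/eqP => /eqP; rewrite subr_eq0 => /eqP -> /eqP; rewrite subr_eq0 => /eqP.
by move=> [e1 e2]; apply/eqP; congr pair; rewrite /= ?e1 ?e2 subrr.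
Qed.

(** Ohm's law is the graph of the shear (a, b) to (a + Z b, b), which preserves
    the symplectic form; testing against (1, 0) and (0, 1), each paired
    with its image, shows that the graph is maximal. *)
Lemma ohm_lagrangian : lagrangian (@rel_omega k 1 1) ohm_space.
Proof.
apply: mk_lagrangian.
  move=> [x y] [x' y'] /ohm_spaceP[/eqP + e2] /ohm_spaceP[/eqP + e2'].
  rewrite !subr_eq => /eqP e1 /eqP e1'.
  by rewrite /rel_omega /omega /omega1 !big_ord1 /= e1 e1' -e2 -e2'; ring.
move=> [x y] h; apply/ohm_spaceP.
have t a b : let u : pc k 1 := [ffun=> (a, b)] in
    let v : pc k 1 := [ffun=> (a + Z * b, b)] in
    rel_omega (x, y) (u, v) = 0.
  by apply: h; apply/ohm_spaceP; rewrite !ffunE /=; split=> //; ring.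
have := t 0 1; have := t 1 0.
rewrite /rel_omega /omega /omega1 !big_ord1 /= !ffunE /=.
set x1 := (x _).1; set x2 := (x _).2; set y1 := (y _).1; set y2 := (y _).2 => /eqP e1 /eqP e2.
have {}e1 : x2 = y2.
  by apply/eqP; rewrite -subr_eq0 -(eqP e1); apply/eqP; ring.
split=> //; apply/eqP; rewrite -subr_eq0 e1 -(eqP e2); apply/eqP; ring.
Qed.

Definition resistor : lagrel k 1 1 := exist _ ohm_space ohm_lagrangian.

Lemma resistorP x y : related resistor x y <->
  (y ord0).1 - (x ord0).1 = Z * (x ord0).2 /\ (x ord0).2 = (y ord0).2.
Proof. exact: ohm_spaceP. Qed.

End Resistor.

Lemma related_tens_all e (f : 'I_e -> lagrel k 1 1) x y :
  related (tens_all (A := LagRel k) f) x y ->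
  forall i, related (f i) [ffun=> x i] [ffun=> y i].
Proof.
elim: e f x y => [|e IH] f x y /=; first by move=> _ [].
rewrite [related _ _ _](@lagrel_tensE k 1 1 e e) => /andP[h0 h] i.
case: (@split_ordP 1 e i) => j ->; last by have := IH _ _ _ h j; rewrite !ffunE.
rewrite (ord1 j) (_ : lshift e ord0 = ord0); last exact: val_inj.
congr related: h0; apply/ffunP => a; rewrite !ffunE (ord1 a);
  by congr fun_of_fin; apply: val_inj.
Qed.

(** * States of a circuit *)

(** Kirchhoff's current law, summed against q over all nodes. *)
Lemma balanced_weak m n (c : cospan m n) (x : pc k m) (y : pc k n) : balanced c x y ->
  forall q : apex c -> k,
    \sum_i q (lleg c i) * (x i).2 = \sum_j q (rleg c j) * (y j).2.
Proof.
move=> b q; have E N (l : 'I_N -> apex c) (u : pc k N) :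
    \sum_i q (l i) * (u i).2 = \sum_s q s * \sum_(i | l i == s) (u i).2.
  rewrite (partition_big l xpredT) //=; apply: eq_bigr => s _; rewrite mulr_sumr.
  by apply: eq_bigr => i /eqP ->.
by rewrite !E; apply: eq_bigr => s _; rewrite b.
Qed.

(** The last condition is the current law in weak form: with q the indicator of a node it says that
    the currents entering and leaving this node are equal. *)
Definition operates m n (c : circuit k m n) (x : pc k m) (y : pc k n)
    (p : apex c -> k) (I : edges c -> k) : Prop :=
  [/\ forall i, (x i).1 = p (lleg c i),
      forall j, (y j).1 = p (rleg c j),
      forall e, p (tgt e) - p (src e) = lab e * I e
    & forall q : apex c -> k,
        \sum_i q (lleg c i) * (x i).2 + \sum_e (q (tgt e) - q (src e)) * I e =
        \sum_j q (rleg c j) * (y j).2].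

(** The image of the normal form of c; in this form it is a composite of
    Lagrangian relations, hence Lagrangian. *)
Definition black_box m n (c : circuit k m n) : lagrel k m n :=
  lagrel_comp (K_cospan k (source_cospan c))
    (lagrel_comp
      (lagrel_tens (tens_all (A := LagRel k) (fun i => resistor (edge_lab i)))
        (lagrel_id k #|apex c|))
      (K_cospan k (target_cospan c))).

(** An element of the composite passes through values u and v on the E + N
    intermediate wires. The potential can be read off the last N wires and the
    edge currents off the first E; the currents on the last N wires cancel
    between the balance equations of the two cospans. *)
Lemma black_box_operates m n (c : circuit k m n) x y :
  related (black_box c) x y -> exists p I, @operates m n c x y p I.
Proof.
case/lagrel_compP => u /K_spaceP[[p [px pu]] bu] /lagrel_compP[v].
rewrite lagrel_tensE lagrel_idE => /andP[/related_tens_all uv /eqP vu].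
move=> /K_spaceP[[p' [pv py]] bv].
have uvN b : v (rshift _ b) = u (rshift _ b).
  by move/ffunP/(_ b): vu; rewrite !ffunE.
have pp' s : p' s = p s.
  have := pv (rshift _ (enum_rank s)); have := pu (rshift _ (enum_rank s)).
  by rewrite /= /end_and_nodes splitR enum_rankK uvN => -> ->.
pose I e := (u (lshift _ (enum_rank e))).2.
have ohm e : p (tgt e) - p (src e) = lab e * I e /\ I e = (v (lshift _ (enum_rank e))).2.
  have := pv (lshift _ (enum_rank e)); have := pu (lshift _ (enum_rank e)).
  have := uv (enum_rank e); rewrite /= /end_and_nodes splitL enum_rankK pp'.
  by move=> /resistorP; rewrite !ffunE /edge_lab enum_rankK => -[+ +] <- <-.
exists p, I; split=> // [j|e|q].
- by rewrite py pp'.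
- by case: (ohm e).
have split_sum (w : edges c -> apex c) (v' : pc k _) :
    \sum_i q (end_and_nodes w i) * (v' i).2 =
    \sum_e q (w e) * (v' (lshift _ (enum_rank e))).2 +
    \sum_b q (enum_val b) * (v' (rshift _ b)).2.
  rewrite big_split_ord (reindex (@enum_rank (edges c))) /=; last first.
    exact: onW_bij (@enum_rank_bij _).
  by congr (_ + _); apply: eq_bigr => i _; rewrite /end_and_nodes ?splitL ?splitR ?enum_rankK.
rewrite (balanced_weak bu q) -(balanced_weak bv q) /= !split_sum.
under [in RHS]eq_bigr do rewrite -(proj2 (ohm _)).
under [X in _ = _ + X]eq_bigr do rewrite uvN.
under [X in _ + X = _]eq_bigr do rewrite mulrBl.
by rewrite sumrB; ring.
Qed.

(** Tellegen's theorem: testing the current law of each state against the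
    potential of the other, the edge terms are Z_e I_e I'_e in both cases by
    Ohm's law, and they cancel. *)
Lemma tellegen m n (c : circuit k m n) x y p I x' y' p' I' :
  @operates m n c x y p I -> @operates m n c x' y' p' I' -> omega x x' = omega y y'.
Proof.
move=> [px py oI b] [px' py' oI' b'].
have E N (u u' : pc k N) (l : 'I_N -> apex c) :
    (forall i, (u i).1 = p (l i)) -> (forall i, (u' i).1 = p' (l i)) ->
    omega u u' = \sum_i p (l i) * (u' i).2 - \sum_i p' (l i) * (u i).2.
  by move=> pu pu'; rewrite -sumrB; apply: eq_bigr => i _; rewrite /omega1 pu pu'.
rewrite (E _ _ _ _ px px') (E _ _ _ _ py py') -b -b'.
have -> : \sum_e (p (tgt e) - p (src e)) * I' e = \sum_e (p' (tgt e) - p' (src e)) * I e.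
  by apply: eq_bigr => e _; rewrite oI oI'; ring.
by ring.
Qed.

(** States give elements by maximality of Lagrangian relations: by [tellegen] a
    state is orthogonal to all elements, since these come from states. *)
Lemma black_boxP m n (c : circuit k m n) x y :
  related (black_box c) x y <-> exists p I, @operates m n c x y p I.
Proof.
split=> [|[p [I o]]]; first exact: black_box_operates.
by apply: lagrel_max => x' y' /black_box_operates[p' [I' o']]; apply: tellegen o o'.
Qed.

(** * Functoriality *)

Lemma black_box_cospan m n (c : cospan m n) :
  black_box (circuit_of_cospan k c) = K_cospan k c.
Proof.
apply/esym/lagrel_sub => x y /K_spaceP[[p [px py]] b]; apply/black_boxP.
exists p, (of_void k); split=> //= q.
by rewrite (balanced_weak b) big_pred0 ?addr0 => [|[]].
Qed.

Lemma black_box_edge Z : black_box (circuit_edge Z) = resistor Z.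
Proof.
apply/esym/lagrel_sub => x y /resistorP[ohm cur]; apply/black_boxP.
exists (fun b : bool => if b then (y ord0).1 else (x ord0).1), (fun _ => (x ord0).2).
split=> //= [i|j|q]; rewrite ?ord1 // !big_ord1 -cur.
have -> F : \sum_(e : unit) F e = F tt :> k.
  by rewrite (big_pred1 tt) // => -[].
ring.
Qed.

Lemma black_box_iso m n (c d : circuit k m n) : circuit_iso c d -> black_box c = black_box d.
Proof.
move=> cd; have {cd} [h [e [[hb hl hr] [eb es et el]]]] := circuit_iso_sym cd.
apply: lagrel_sub => x y /black_boxP[p [I [px py ohm b]]]; apply/black_boxP.
exists (p \o h), (I \o e); split=> [i|j|a|q] /=.
- by rewrite hl.
- by rewrite hr.
- by rewrite -et -es ohm el.
case: (hb) => h' hK hK'; have := b (q \o h').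
rewrite [X in _ + X = _ -> _](reindex e) /=; last exact: onW_bij.
under eq_bigr do rewrite -hl hK.
under [X in _ + X = _ -> _]eq_bigr do rewrite es et !hK.
by under [X in _ = X -> _]eq_bigr do rewrite -hr hK.
Qed.

(** The two potentials agree on the shared terminals, so they glue on the
    pushout; a test function on the pushout restricts to both parts, and the
    currents through the shared terminals cancel. *)
Lemma black_box_comp m n p (c : circuit k m n) (d : circuit k n p) :
  black_box (circuit_comp c d) = lagrel_comp (black_box c) (black_box d).
Proof.
apply/esym/lagrel_sub => x z /lagrel_compP[y].
move=> /black_boxP[q [I [qx qy ohm b]]] /black_boxP[r [J [ry rz ohm' b']]].
apply/black_boxP.
have [ab j u] := pushoutP (rleg c) (lleg d).
have [|w [wl wr]] := u _ q r; first by move=> i; rewrite -qy -ry.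
exists w, (fun e => match e with inl e => I e | inr e => J e end).
split=> [i|i|[e|e]|t] /=; rewrite ?wl ?wr //.
have := b (t \o po_inl (rleg c) (lleg d)); have := b' (t \o po_inr (rleg c) (lleg d)) => /= <-.
rewrite big_sumType /= addrA => ->; congr (_ + _).
by apply: eq_bigr => i _; rewrite ab.
Qed.

Lemma black_box_tens m n p q (c : circuit k m n) (d : circuit k p q) :
  black_box (circuit_tens c d) = lagrel_tens (black_box c) (black_box d).
Proof.
apply/esym/lagrel_sub => x y; rewrite lagrel_tensE.
move=> /andP[/black_boxP[r [I [rx ry ohm b]]] /black_boxP[s [J [sx sy ohm' b']]]].
apply/black_boxP.
exists (fun v => match v with inl v => r v | inr v => s v end).
exists (fun e => match e with inl e => I e | inr e => J e end).
split=> [i|i|[e|e]|t] /=; rewrite ?ohm ?ohm' //.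
- by case: (split_ordP i) => a -> /=; rewrite -?rx -?sx ffunE.
- by case: (split_ordP i) => a -> /=; rewrite -?ry -?sy ffunE.
have := b (t \o inl); have := b' (t \o inr) => /=.
rewrite big_sumType !big_split_ord /=.
have E N M (T T' : Type) (l : 'I_N -> T) (l' : 'I_M -> T') (f : T + T' -> k)
    (v : pc k (N + M)) :
    \sum_(i < N) f (sum_map l l' (split (lshift M i))) * (v (lshift M i)).2 =
      \sum_i f (inl (l i)) * (pcl v i).2 /\
    \sum_(i < M) f (sum_map l l' (split (rshift N i))) * (v (rshift N i)).2 =
      \sum_i f (inr (l' i)) * (pcr v i).2.
  by split; apply: eq_bigr => i _; rewrite ?splitL ?splitR ffunE.
by rewrite !(proj1 (E _ _ _ _ _ _ _ _)) !(proj2 (E _ _ _ _ _ _ _ _)) => <- <-; ring.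
Qed.

Lemma black_box_repr m n (c : circuit k m n) :
  black_box (qrepr (cls (@circuit_iso k m n) c)) = black_box c.
Proof. exact/black_box_iso/circuit_iso_sym/(repr_cls (@circuit_iso_refl k m n)). Qed.

Definition black_box_mor : prop_mor (Circ k) (LagRel k).
Proof.
exists (fun m n (x : circuit_cls k m n) => black_box (qrepr x)).
- move=> n; rewrite /= black_box_repr black_box_cospan.
  exact: (@K_cospan_graph k n n id (lagrel_id k n) (inv_bij (fun=> erefl)) (is_graph_id (n:=n))).
- by move=> m n p f g; rewrite /= black_box_repr black_box_comp.
- by move=> m n p q f g; rewrite /= black_box_repr black_box_tens.
- move=> m n; rewrite /= black_box_repr black_box_cospan.
  exact: (@K_cospan_graph k _ _ (@ord_swap n m) (lagrel_sym k m n)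
    (Bijective (@ord_swapK n m) (@ord_swapK m n)) (is_graph_sym (m:=m) (n:=n))).
Defined.

(** By [fincospan_mor_ext] only the four values of K on the generating corelations
    matter, and these are prescribed. *)
Lemma K_after_H (K : prop_mor FinCorel (LagRel k)) : K_on_generators K ->
  prop_mor_comp K H_mor = prop_mor_comp (K_mor k) H_mor.
Proof.
have compE (F : prop_mor FinCorel (LagRel k)) m n (x : hom FinCospan m n) :
  mor_map (prop_mor_comp F H_mor) x = mor_map F (mor_map H_mor x) by [].
have [mu delta iota eps] := K_mor_on_generators k.
move=> [mu' delta' iota' eps']; apply: fincospan_mor_ext; rewrite !compE.
- rewrite (corel_of_cospanK corel_mu : mor_map H_mor (block 2 1) = _).
  by apply: lagrel_ext => x y; apply: iff_trans (mu' x y) (iff_sym (mu x y)).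
- rewrite (corel_of_cospanK corel_delta : mor_map H_mor (block 1 2) = _).
  by apply: lagrel_ext => x y; apply: iff_trans (delta' x y) (iff_sym (delta x y)).
- rewrite (corel_of_cospanK corel_iota : mor_map H_mor (block 0 1) = _).
  by apply: lagrel_ext => x y; apply: iff_trans (iota' x y) (iff_sym (iota x y)).
- rewrite (corel_of_cospanK corel_epsilon : mor_map H_mor (block 1 0) = _).
  by apply: lagrel_ext => x y; apply: iff_trans (eps' x y) (iff_sym (eps x y)).
Qed.

End BlackBox.

Theorem theorem9p4 (k : fieldType) (K : prop_mor FinCorel (LagRel k))
    (K_spec : K_on_generators K) :
  exists! box : prop_mor (Circ k) (LagRel k),
    prop_mor_comp box (cospan_to_circ k) = prop_mor_comp K H_mor /\
    forall (Z : k) (x y : pc k 1),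
      related (mor_map box (circ_edge Z)) x y <->
      (y ord0).1 - (x ord0).1 = Z * (x ord0).2 /\ (x ord0).2 = (y ord0).2.
Proof.
have boxE Z : mor_map (black_box_mor k) (circ_edge Z) = resistor Z.
  by rewrite /= black_box_repr black_box_edge.
have boxH : prop_mor_comp (black_box_mor k) (cospan_to_circ k) = prop_mor_comp K H_mor.
  rewrite K_after_H //; apply: eq_prop_mor => m n x.
  by rewrite /= black_box_repr black_box_cospan K_cospan_repr K_cospan_restrict.
exists (black_box_mor k); split=> [|box [box_H box_edge]].
  by split=> // Z x y; rewrite boxE; apply: resistorP.
apply: circ_mor_ext => [|Z]; first by rewrite boxH box_H.
rewrite boxE; apply: lagrel_ext => x y.
exact: iff_trans (resistorP Z x y) (iff_sym (box_edge Z x y)).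
Qed.
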